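(* Suppose that the random cocycle $(\Omega,m,\sigma,\mathcal B_\omega,\tilde{\mathcal L}_{\omega,0})$ is admissible (see context). Take a sequence of nonnegative observables $v_n:\Omega\times[0,1]\to[0,\infty)$, $v_{n,\omega}=v_n(\omega,\cdot)$, satisfying $\sup_n\operatorname{ess\,sup}_\omega\|v_{n,\omega}\|_{\mathcal B_\omega}\le M$. Suppose that for $m$-a.e. $\omega\in\Omega$ $$E_{\omega,n}:=\sum_{k=0}^{n-1}\int v_{k,\sigma^k\omega}(x)\,d\mu_{\sigma^k\omega,0}(x)\to\infty,\qquad n\to\infty.$$ Then for $m$-a.e. $\omega\in\Omega$ $$\lim_{n\to\infty}\frac1{E_{\omega,n}}\sum_{k=0}^{n-1}v_{k,\sigma^k\omega}(T_\omega^kx)=1$$ for $\mu_{\omega,0}$-almost all $x$.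
   Context: **Closed system.** $(\Omega,\mathscr F,m)$ is a probability space, $\sigma:\Omega\to\Omega$ invertible, ergodic, $m$-preserving. Each $T_\omega:[0,1]\to[0,1]$ is surjective, finitely branched, piecewise monotone and nonsingular with respect to $\mathrm{Leb}$, $T_\omega^n=T_{\sigma^{n-1}\omega}\circ\dots\circ T_\omega$; weights $g_{\omega,0}\in \mathrm{BV}$; $\mathcal L_{\omega,0}f(x)=\sum_{y\in T_\omega^{-1}(x)}g_{\omega,0}(y)f(y)$, $g_{\omega,0}^{(n)}=\prod_{j=0}^{n-1}g_{\sigma^j\omega,0}\circ T_\omega^j$. Assume: $\operatorname{ess\,sup}_\omega|T'_\omega|<\infty$ and $\operatorname{ess\,sup}_\omega\sup_y\#T_\omega^{-1}(y)<\infty$; $\operatorname{ess\,sup}_\omega\|g_{\omega,0}\|_{L^\infty(\mathrm{Leb})}<\infty$, $\operatorname{ess\,inf}_\omega\inf g_{\omega,0}>0$; for every subinterval $J$ there is $k(J)$ with $T_\omega^{k(J)}(J)=[0,1]$ for a.e. $\omega$; for some $n'\ge1$, $9\operatorname{ess\,sup}_\omega\|g_{\omega,0}^{(n')}\|_{L^\infty(\mathrm{Leb})}<\operatorname{ess\,inf}_\omega\inf\mathcal L_{\omega,0}^{n'}\mathbf 1$. There are a random probability measure $\{\nu_{\omega,0}\}$ (fibre probability measures, measurable in $\omega$), non-atomic and fully supported on $[0,1]$, measurable $\lambda_0:\Omega\to(0,\infty)$ with $\log\lambda_{\omega,0}\in L^1(m)$ and a measurable family $\phi_{\omega,0}>0$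 in $\mathrm{BV}$ with $\nu_{\sigma\omega,0}(\mathcal L_{\omega,0}f)=\lambda_{\omega,0}\nu_{\omega,0}(f)$, $\mathcal L_{\omega,0}\phi_{\omega,0}=\lambda_{\omega,0}\phi_{\sigma\omega,0}$, $\nu_{\omega,0}(\phi_{\omega,0})=1$; $\mu_{\omega,0}=\phi_{\omega,0}\nu_{\omega,0}$ is the equivariant family of probability measures. $\tilde{\mathcal L}_{\omega,0}=\lambda_{\omega,0}^{-1}\mathcal L_{\omega,0}$, with $\tilde{\mathcal L}^n_{\omega,0}$ the composition along the orbit. $\mathcal B_\omega$ is the Banach space of ($\nu_{\omega,0}$-classes of) functions of bounded variation on $[0,1]$ with norm $\|f\|_{\mathcal B_\omega}=\mathrm{var}(f)+\nu_{\omega,0}(|f|)$, where $\mathrm{var}$ is the minimal variation over the $\nu_{\omega,0}$-equivalence class. **Admissibility.** The cocycle is admissible if: ($\mathcal C$0) $\sigma$ is a homeomorphism, $T(\omega,x)=(\sigma\omega,T_\omega x)$ is measurable, and $\omega\mapsto T_\omega$ has countable range. ($\mathcal C$1) There is $K$ independent of $\omega$ with $\|\tilde{\mathcal L}_{\omega,0}f\|_{\mathcal B_{\sigma\omega}}\le K\|f\|_{\mathcal B_\omega}$ for all $f\in\mathcal B_\omega$ and $m$-a.e. $\omega$. ($\mathcal C$2) There are $N\in\mathbb N$ and measurable $\tilde\alpha^N,\tilde\beta^N:\Omega\to(0,\infty)$ with $\int_\Omega\log\tilde\alpha^N\,dm<0$ such that for every $f\in\mathcal B_\omega$ and $m$-a.e.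 $\omega$, $\|\tilde{\mathcal L}^N_{\omega,0}f\|_{\mathcal B_{\sigma^N\omega}}\le\tilde\alpha^N(\omega)\|f\|_{\mathcal B_\omega}+\tilde\beta^N(\omega)\|f\|_{L^1(\nu_{\omega,0})}$. ($\mathcal C$3) There are $D>0$, $\kappa\in(0,1)$ with $\|\tilde{\mathcal L}^n_{\omega,0}f-\nu_{\omega,0}(f)\phi_{\sigma^n\omega,0}\|_{\mathcal B_{\sigma^n\omega}}\le D\|f\|_{\mathcal B_\omega}\kappa^n$ for all $n$, $f\in\mathcal B_\omega$ and $m$-a.e. $\omega$. ($\mathcal C$4) $\operatorname{ess\,sup}_\omega\|\phi_{\omega,0}\|_{\mathcal B_\omega}<\infty$, $\operatorname{ess\,inf}_\omega\inf\phi_{\omega,0}>0$, and correlations decay exponentially: there is $C>0$ with $|\mu_{\omega,0}((f\circ T_\omega^n)h)-\mu_{\sigma^n\omega,0}(f)\mu_{\omega,0}(h)|\le C\|f\|_{L^\infty(\nu_{\sigma^n\omega,0})}\|h\|_{\mathcal B_\omega}\kappa^n$ for $f,h\in \mathrm{BV}$, $n$ sufficiently large, $m$-a.e. $\omega$. *)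

(* Defs.v *)
From HB Require Import structures.
From mathcomp Require Export all_boot all_order all_algebra.
From mathcomp Require Export all_classical all_reals all_analysis.
From mathcomp Require Export ess_sup_inf.
Export Order.TTheory GRing.Theory Num.Theory.
Export numFieldNormedType.Exports.

Set Implicit Arguments.
Unset Strict Implicit.
Unset Printing Implicit Defensive.

Local Open Scope classical_set_scope.
Local Open Scope ring_scope.

(* Functions on [0,1] are functions R -> R of which only the values on `[0, 1]
   are ever used, and measures on [0,1] are measures on R carried by `[0, 1]. *)

Notation I01 := (`[0%R, 1%R]%classic).

(* No compatibility between topology and sigma-algebra is assumed. *)
#[short(type="topMeasurableType")]
HB.structure Definition TopMeasurable d := {T of Topological T & Measurable d T}.

Definition inf01 (R : realType) (f : R -> R) : \bar R :=
  ereal_inf [set (f x)%:E | x in I01].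

Definition leb01 {R : realType} : {measure set (measurableTypeR R) -> \bar R} :=
  mrestr (@lebesgue_measure R) (measurable_itv `[0%R, 1%R]).

Section BV_nu.
Context (R : realType) (nu : {measure set R -> \bar R}).

Definition L1norm (f : R -> R) : \bar R := (\int[nu]_(x in I01) `|f x|%:E)%E.

Definition mean (f : R -> R) : R := \int[nu]_(x in I01) f x.

(* The variation of the nu-class of f; it is +oo iff no function of bounded
   variation is nu-a.e. equal to f. *)
Definition class_var (f : R -> R) : \bar R :=
  ereal_inf [set total_variation 0 1 g | g in
    [set g : R -> R | {ae nu, forall x, I01 x -> f x = g x}]].

Definition Bnorm (f : R -> R) : \bar R := (class_var f + L1norm f)%E.

End BV_nu.

(* Strictly monotone and continuous on each of finitely many open intervals;
   the values at the finitely many break points are arbitrary. *)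
Definition piecewise_monotone (R : realType) (f : R -> R) :=
  exists s : seq R, itv_partition 0 1 s /\
    forall i, (i < size s)%N ->
      let J := (`]nth 0 (0 :: s) i, nth 0 (0 :: s) i.+1[) in
      ({in J &, {mono f : x y / x < y}} \/ {in J &, {mono f : x y /~ x < y}})
      /\ {in J, continuous f}.

Record random_map d (Omega : topMeasurableType d) (R : realType) := RandomMap {
  rm_sigma : Omega -> Omega ;
  rm_T : Omega -> R -> R ;
  rm_g : Omega -> R -> R ;
  rm_nu : R.-pker Omega ~> R ;
  rm_lambda : Omega -> R ;
  rm_phi : Omega -> R -> R ;
  rm_mu : Omega -> probability R R }.

Section closed_system.
Context d (Omega : topMeasurableType d) (R : realType).
Variables (m : probability Omega R) (S : random_map Omega R).

Local Notation sigma := (rm_sigma S).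
Local Notation T := (rm_T S).
Local Notation g := (rm_g S).
Local Notation nu := (rm_nu S).
Local Notation lambda := (rm_lambda S).
Local Notation phi := (rm_phi S).
Local Notation mu := (rm_mu S).

Definition orb (k : nat) : Omega -> Omega := iter k sigma.

Fixpoint Tn (n : nat) (w : Omega) (x : R) : R :=
  if n is k.+1 then T (orb k w) (Tn k w x) else x.

Definition fibre w (x : R) : set R := I01 `&` T w @^-1` [set x].

Definition transfer w (f : R -> R) (x : R) : R :=
  \sum_(y \in fibre w x) g w y * f y.

Fixpoint transfern (n : nat) w (f : R -> R) : R -> R :=
  if n is k.+1 then transfer (orb k w) (transfern k w f) else f.

Definition gn (n : nat) w (x : R) : R := \prod_(j < n) g (orb j w) (Tn j w x).

Definition ntransfer w (f : R -> R) (x : R) : R := (lambda w)^-1 * transfer w f x.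

Fixpoint ntransfern (n : nat) w (f : R -> R) : R -> R :=
  if n is k.+1 then ntransfer (orb k w) (ntransfern k w f) else f.

Definition invertible_mp_ergodic :=
  [/\ measurable_fun setT sigma,
      exists tau, [/\ cancel sigma tau, cancel tau sigma & measurable_fun setT tau],
      forall A, measurable A -> m (sigma @^-1` A) = m A
    & forall A, measurable A -> sigma @^-1` A = A -> m A = 0%E \/ m A = 1%E].

Definition nonsingular (f : R -> R) :=
  forall A : set R, measurable A -> leb01 A = 0%E -> leb01 (f @^-1` A) = 0%E.

(* cs_derivative: the derivative of a piecewise monotone map exists Lebesgue-a.e.,
   so the arbitrary value of derive1 elsewhere is invisible to ess_sup.
   cs_eigen: an identity in B_(sigma w), hence nu (sigma w)-almost everywhere. *)
Record closed_system : Prop := {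
  cs_sigma : invertible_mp_ergodic ;
  cs_surj : forall w, T w @` I01 = I01 ;
  cs_monotone : forall w, piecewise_monotone (T w) ;
  cs_nonsingular : forall w, nonsingular (T w) ;
  cs_g_BV : forall w, bounded_variation 0 1 (g w) ;
  cs_derivative :
    (ess_sup m (fun w => ess_sup leb01 (fun x : R => `|derive1 (T w) x|%:E)) < +oo)%E ;
  cs_degree :
    (ess_sup m (fun w => ereal_sup [set counting (fibre w y) | y in I01])
       < +oo)%E ;
  cs_g_bounded :
    (ess_sup m (fun w => Lnorm leb01 +oo (EFin \o g w)) < +oo)%E ;
  cs_g_pos : (0 < ess_inf m (fun w => inf01 (g w)))%E ;
  cs_covering : forall J : set R,
    is_interval J -> J `<=` I01 -> (exists x y, [/\ J x, J y & x < y]) ->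
    exists k : nat, {ae m, forall w, Tn k w @` J = I01} ;
  cs_contraction : exists2 n : nat, (1 <= n)%N &
    (9%:R%:E * ess_sup m (fun w => Lnorm leb01 +oo (EFin \o gn n w)) <
      ess_inf m (fun w => inf01 (transfern n w (cst 1%R))))%E ;
  cs_nu_carrier : forall w, nu w I01 = 1%E ;
  cs_nu_nonatomic : {ae m, forall w, forall x, nu w [set x] = 0%E} ;
  cs_nu_full : {ae m, forall w, forall U : set R, open U ->
    U `&` I01 !=set0 -> (0 < nu w U)%E} ;
  cs_lambda_measurable : measurable_fun setT lambda ;
  cs_lambda_gt0 : forall w, 0 < lambda w ;
  cs_lambda_integrable : m.-integrable setT (fun w => (ln (lambda w))%:E) ;
  cs_phi_measurable : measurable_fun ([set: Omega] `*` I01 : set (Omega * R)) (fun p : Omega * R => phi p.1 p.2) ;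
  cs_phi_BV : {ae m, forall w, bounded_variation 0 1 (phi w)} ;
  cs_phi_gt0 : {ae m, forall w, forall x, I01 x -> 0 < phi w x} ;
  cs_conformal : {ae m, forall w, forall f, bounded_variation 0 1 f ->
    mean (nu (sigma w)) (transfer w f) = lambda w * mean (nu w) f} ;
  cs_eigen : {ae m, forall w, {ae nu (sigma w), forall x, I01 x ->
    transfer w (phi w) x = lambda w * phi (sigma w) x}} ;
  cs_normalized : {ae m, forall w, mean (nu w) (phi w) = 1} ;
  cs_mu : {ae m, forall w, forall A : set R, measurable A ->
    mu w A = (\int[nu w]_(x in A `&` I01) (phi w x)%:E)%E} ;
  cs_equivariant : {ae m, forall w, forall A : set R, measurable A ->
    mu (sigma w) A = mu w (I01 `&` T w @^-1` A)} }.

Definition C0 :=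
  [/\ continuous sigma /\
      exists tau, [/\ cancel sigma tau, cancel tau sigma & continuous tau],
      measurable_fun ([set: Omega] `*` I01 : set (Omega * R)) (fun p : Omega * R => (sigma p.1, T p.1 p.2))
    & countable (range (fun w => T w \_ I01))].

(* Elements of B_w are represented by functions of bounded variation, the norm
   Bnorm (nu w) depending only on the nu w-class. *)
Definition C1 := exists K : R, {ae m, forall w, forall f, bounded_variation 0 1 f ->
  (Bnorm (nu (sigma w)) (ntransfer w f) <= K%:E * Bnorm (nu w) f)%E}.

(* The clause on the positive part makes \int log alpha meaningful in
   [-oo, +oo[; otherwise +oo - oo = -oo would count as negative. *)
Definition C2 := exists (N : nat) (alpha beta : Omega -> R),
  [/\ measurable_fun setT alpha /\ (forall w, 0 < alpha w),
      measurable_fun setT beta /\ (forall w, 0 < beta w),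
      (\int[m]_w (Num.max (ln (alpha w)) 0)%:E < +oo)%E,
      (\int[m]_w (ln (alpha w))%:E < 0)%E
    & {ae m, forall w, forall f, bounded_variation 0 1 f ->
        (Bnorm (nu (orb N w)) (ntransfern N w f) <=
          (alpha w)%:E * Bnorm (nu w) f + (beta w)%:E * L1norm (nu w) f)%E}].

Definition C3 (kappa : R) := exists2 D : R, 0 < D &
  {ae m, forall w, forall n f, bounded_variation 0 1 f ->
    (Bnorm (nu (orb n w))
       (fun x => (ntransfern n w f x - mean (nu w) f * phi (orb n w) x)%R) <=
     D%:E * Bnorm (nu w) f * (kappa ^+ n)%:E)%E}.

Definition C4 (kappa : R) :=
  [/\ (ess_sup m (fun w => Bnorm (nu w) (phi w)) < +oo)%E,
      (0 < ess_inf m (fun w => inf01 (phi w)))%E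
    & exists2 C : R, 0 < C & exists n0 : nat, {ae m, forall w, forall n f h,
        (n0 <= n)%N -> bounded_variation 0 1 f -> bounded_variation 0 1 h ->
        (`|mean (mu w) (fun x => f (Tn n w x) * h x)
           - mean (mu (orb n w)) f * mean (mu w) h|%:E <=
         C%:E * Lnorm (nu (orb n w)) +oo (EFin \o f) * Bnorm (nu w) h
           * (kappa ^+ n)%:E)%E}].

(* The rate kappa is common to C3 and C4. *)
Definition admissible := [/\ C0, C1, C2
  & exists2 kappa : R, 0 < kappa < 1 & C3 kappa /\ C4 kappa].

Definition cumulative_mean (v : nat -> Omega -> R -> R) (w : Omega) (n : nat) : R :=
  \sum_(k < n) mean (mu (orb k w)) (v k (orb k w)).

End closed_system.

(* Main.v *)
Require Import Defs.
From mathcomp Require Import measurable_realfun ring lra zify.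

(** Fix a typical w and put Y_k(x) = v_(k, sigma^k w) (T_w^k x), with mean e_k
    and E_n = e_0 + .. + e_(n-1).  Everything rests on the correlation bound

      E (Y_j Y_(j+n)) <= e_j e_(j+n) + C kappa^n e_(j+n),

    in which the error carries the mean of the later observable and not merely
    its supremum.  Summing it over pairs makes the variance of
    Y_0 + .. + Y_(n-1) at most K E_n (variance_le), however slowly E_n grows;
    an error of order kappa^n alone would only give a bound of order n.
    Let n_j be the first time E reaches (j+1)^2.  The squared relative
    deviations at the times n_j have expectations at most K / (j+1)^2, hence a
    summable series, so the ratio tends to 1 along (n_j).  The e_k are bounded,
    so E_(n_(j+1)) / E_(n_j) tends to 1 too, and as the partial sums of the Y_k
    are nondecreasing the remaining times are sandwiched between consecutive
    n_j (ratio_interpolation).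

    The correlation bound comes from duality: for f and h of bounded variation
    the integral of (f o T_w^n) h against nu_w is that of f (L^n h) against
    nu_(sigma^n w), L being the normalized transfer operator
    (ntransfern_duality).  With h the product of the earlier observable and of
    phi_w, the spectral gap says that L^n h is within O(kappa^n) of its limit
    in the norm of B, which dominates the supremum norm almost everywhere
    (ae_le_Bnorm).  What is left of f is its integral against nu, comparable to
    its mu-mean because phi is bounded below (decay_of_correlations).

    Conformality and the spectral gap only speak of functions of bounded
    variation.  One therefore replaces each observable by a representative of
    bounded variation (Bnorm_representative), and one needs that f o T and the
    transfer of f have bounded variation when f does.  This is proved branch by
    branch (BV_piece): for monotone f both are, on each branch, monotone
    functions cut off outside an interval. *)

Set Implicit Arguments.
Unset Strict Implicit.
Unset Printing Implicit Defensive.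

Local Open Scope classical_set_scope.
Local Open Scope ring_scope.

(** * Sums and limits of real sequences *)

Section real_sequences.
Context {R : realType}.
Implicit Types (s E : nat -> R).

Lemma first_passage E : nondecreasing_seq E -> E @ \oo --> +oo -> forall c,
  exists2 n, c <= E n & forall i, (i < n)%N -> E i < c.
Proof.
move=> ndE Eoo c.
have ex : exists n, c <= E n.
  move/cvgryPge : Eoo => /(_ c)[n _ nE]; exists n; exact: nE (leqnn n).
exists (ex_minn ex); case: ex_minnP => n cn nmin // i ni.
by rewrite ltNge; apply/negP => /nmin; rewrite leqNgt ni.
Qed.

Lemma square_bracket (y : R) : 1 <= y ->
  exists j : nat, (j.+1)%:R ^+ 2 <= y < (j.+2)%:R ^+ 2.
Proof.
move=> y1; have ex : exists k : nat, y < (k.+1)%:R ^+ 2.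
  exists (Num.bound y); have := archi_boundP (le_trans ler01 y1).
  set N := Num.bound y => yN.
  have N0 : 0 <= N%:R :> R by [].
  rewrite -natr1 (lt_le_trans yN)//; nra.
case: (ex_minnP ex) => -[|j] yj jmin; first by move: yj; rewrite expr1n ltNge y1.
exists j; rewrite yj andbT leNgt; apply/negP => /jmin.
by rewrite ltnn.
Qed.

Lemma cvg_natr_square_ratio (b : R) :
  (((j.+2)%:R ^+ 2 + b) / (j.+1)%:R ^+ 2) @[j --> \oo] --> (1 : R).
Proof.
have h := @cvg_harmonic R.
have -> : (fun j => ((j.+2)%:R ^+ 2 + b) / (j.+1)%:R ^+ 2) =
   (fun j => (1 + harmonic j) ^+ 2 + b * harmonic j ^+ 2 : R).
  apply/funext => j; rewrite /harmonic /= -[j.+2%:R]natr1.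
  have : (j.+1)%:R != 0 :> R by rewrite pnatr_eq0.
  by move: (j.+1)%:R => x x0; field.
rewrite -[X in _ --> X]addr0; apply: cvgD.
  rewrite -[X in _ --> X](expr1n _ 2) !expr2.
  have h1 : (1 + harmonic j : R) @[j --> \oo] --> (1 : R).
    rewrite -[X in _ --> X]addr0; apply: cvgD => //; exact: cvg_cst.
  by under eq_fun do rewrite expr2; exact: cvgM.
rewrite -(mulr0 b) -[X in b * X](mulr0 0).
apply: cvgM; first exact: cvg_cst.
by under eq_fun do rewrite expr2; exact: cvgM.
Qed.

(** Between the first passages n_j and n_(j+1) of E through consecutive squares
    both s and E are monotone, so the ratio s n / E n differs from its values at
    these two times by a factor at most E (n_(j+1)) / E (n_j).  The overshoots of
    E being at most b, this factor is at most ((j+2)^2 + b) / (j+1)^2. *)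
Lemma ratio_interpolation s E (n_ : nat -> nat) (b : R) :
  nondecreasing_seq s -> (forall n, 0 <= s n) ->
  nondecreasing_seq E -> E @ \oo --> +oo ->
  (forall j, (j.+1)%:R ^+ 2 <= E (n_ j) <= (j.+1)%:R ^+ 2 + b) ->
  (forall j i, (i < n_ j)%N -> E i < (j.+1)%:R ^+ 2) ->
  ((E (n_ j))^-1 * s (n_ j)) @[j --> \oo] --> (1 : R) ->
  ((E n)^-1 * s n) @[n --> \oo] --> (1 : R).
Proof.
move=> nds s0 ndE Eoo Enb nmin rcvg.
set r := (fun j => (E (n_ j))^-1 * s (n_ j)) in rcvg.
pose rho (j : nat) : R := ((j.+2)%:R ^+ 2 + b) / (j.+1)%:R ^+ 2.
have rhocvg : rho @ \oo --> (1 : R) by exact: cvg_natr_square_ratio.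
have upcvg : (r j.+1 * rho j) @[j --> \oo] --> (1 : R).
  rewrite -[X in _ --> X]mulr1; apply: cvgM => //.
  rewrite (_ : (fun j => r j.+1) = (fun j => r (j + 1)%N)) ?cvg_shiftn//.
  by apply/funext => j; rewrite addn1.
have locvg : (r j / rho j) @[j --> \oo] --> (1 : R).
  rewrite -[X in _ --> X]mulr1 -[X in _ * X]invr1; apply: cvgM => //.
  by apply: cvgV => //; rewrite oner_eq0.
apply/cvgrPdist_le => e e0.
move/cvgrPdist_le : upcvg => /(_ _ e0)[J1 _ HJ1].
move/cvgrPdist_le : locvg => /(_ _ e0)[J2 _ HJ2].
pose J := maxn J1 J2.
move/cvgryPge : Eoo => /(_ ((J.+1)%:R ^+ 2))[N _ HN].
exists N => // n /= Nn; have En := HN _ Nn.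
have [|j /andP[jE Ej]] := @square_bracket (E n).
  rewrite (le_trans _ En)// -[leLHS](expr1n _ 2) ler_sqr ?nnegrE//.
  by rewrite ler1n.
have Jj : (J <= j)%N.
  have := le_lt_trans En Ej; rewrite ltr_sqr ?nnegrE// ltr_nat !ltnS; lia.
have njn : (n_ j <= n)%N.
  by rewrite leqNgt; apply/negP => /nmin; rewrite ltNge jE.
have nnj : (n <= n_ j.+1)%N.
  rewrite leqNgt; apply/negP => /ltnW/ndE; have /andP[+ _] := Enb j.+1.
  by move=> H1 H2; move: (lt_le_trans Ej (le_trans H1 H2)); rewrite ltxx.
have sq0 (k : nat) : 0 < (k.+1)%:R ^+ 2 :> R by rewrite exprn_gt0.
have Enj0 k : 0 < E (n_ k) by have /andP[+ _] := Enb k; exact: lt_le_trans.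
have En0 : 0 < E n by exact: lt_le_trans jE.
have b0 : 0 <= b.
  by have /andP[H1 H2] := Enb 0%N; have := le_trans H1 H2; rewrite lerDl.
have rho0 : 0 < rho j by rewrite divr_gt0// ltr_wpDr.
have Erho : E (n_ j.+1) <= rho j * E (n_ j).
  have /andP[_ H1] := Enb j.+1; have /andP[H2 _] := Enb j.
  have -> : rho j * E (n_ j) =
      ((j.+2)%:R ^+ 2 + b) * (E (n_ j) / (j.+1)%:R ^+ 2) by rewrite /rho; ring.
  rewrite (le_trans H1)// ler_peMr// ?addr_ge0//.
  by rewrite ler_pdivlMr// mul1r.
have up : (E n)^-1 * s n <= r j.+1 * rho j.
  rewrite ler_pdivrMl//.
  have -> : E n * (r j.+1 * rho j) = s (n_ j.+1) * (rho j * E n / E (n_ j.+1)).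
    by rewrite /r; ring.
  rewrite (le_trans (nds _ _ nnj))// ler_peMr// ler_pdivlMr// mul1r.
  by rewrite (le_trans Erho)// ler_wpM2l ?ndE// ltW.
have lo : r j / rho j <= (E n)^-1 * s n.
  rewrite ler_pdivlMl//.
  have -> : E n * (r j / rho j) = s (n_ j) * (E n / (rho j * E (n_ j))).
    by rewrite /r; field; rewrite !gt_eqF.
  rewrite (le_trans _ (nds _ _ njn))// ler_piMr// ler_pdivrMr; last by rewrite mulr_gt0.
  by rewrite mul1r (le_trans (ndE _ _ nnj)).
have /= := HJ1 j; have /= := HJ2 j.
have j1 : (J1 <= j)%N by apply: leq_trans Jj; exact: leq_maxl.
have j2 : (J2 <= j)%N by apply: leq_trans Jj; exact: leq_maxr.
move=> /(_ j2) + /(_ j1); rewrite !ler_distl => /andP[H1 H2] /andP[H3 H4].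
lra.
Qed.

Lemma sum_geometric_le (k : R) n : 0 < k < 1 ->
  \sum_(j < n) k ^+ (n - j) <= (1 - k)^-1.
Proof.
move=> /andP[k0 k1]; have k1' : 0 < 1 - k by rewrite subr_gt0.
elim: n => [|n IH]; first by rewrite big_ord0 invr_ge0 ltW.
rewrite big_ord_recr/= subSnn expr1.
under eq_bigr => j _ do rewrite subSn 1?ltnW// exprS.
rewrite -mulr_sumr; set s := \sum_(j < n) _ in IH *.
rewrite -[leRHS]mul1r ler_pdivlMr//.
rewrite -[leRHS]mul1r ler_pdivlMr// in IH.
have : k * (s * (1 - k)) <= k * 1 by rewrite ler_wpM2l// ltW.
nra.
Qed.

Lemma sum_inv_square_le n : \sum_(j < n) ((j.+1)%:R ^+ 2)^-1 <= 2 :> R.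
Proof.
(* telescoping: 1 / x^2 <= 2 / x - 2 / (x + 1) for x >= 1 *)
suff : \sum_(j < n) ((j.+1)%:R ^+ 2)^-1 <= 2 - 2 / (n.+1)%:R :> R.
  by move/le_trans; apply; rewrite gerBl// divr_ge0.
elim: n => [|n IH]; first by rewrite big_ord0 divr1 subrr.
rewrite big_ord_recr/= (le_trans (lerD IH (lexx _)))// -[n.+2%:R]natr1.
have : 1 <= n.+1%:R :> R by rewrite ler1n.
move: (n.+1)%:R => x x1; have x0 : 0 < x by lra.
rewrite -lerBrDl -subr_ge0.
have -> : 2 - 2 / (x + 1) - (2 - 2 / x) - (x ^+ 2)^-1 = (x - 1) / (x ^+ 2 * (x + 1)).
  by field; rewrite !gt_eqF//; lra.
by rewrite divr_ge0 ?mulr_ge0 ?sqr_ge0//; lra.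
Qed.

End real_sequences.

(** * A strong law for weakly correlated bounded variables *)

Section strong_law.
Context d (T : measurableType d) (R : realType) (mu : {measure set T -> \bar R}).
Variable D : set T.
Hypotheses (mD : measurable D) (muD : mu D = 1%E).

Definition bounded_measurable (f : T -> R) :=
  measurable_fun D f /\ exists a, forall x, D x -> `|f x| <= a.

Local Notation bm := bounded_measurable.
Local Notation "'E_ f" := (\int[mu]_(x in D) f x) (at level 10, f at level 8).

Lemma bounded_measurable_integrable f : bm f -> mu.-integrable D (EFin \o f).
Proof.
move=> [mf [a fa]]; apply: measurable_bounded_integrable => //.
  by rewrite [ltLHS](_ : _ = 1%E)// ltry.
exists a; split; first exact: num_real.
by move=> b ab x /= xD; rewrite (le_trans (fa _ xD))// ltW.
Qed.

Lemma bounded_measurable_cst (c : R) : bm (fun=> c).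
Proof. by split; [exact: measurable_cst|exists `|c|]. Qed.

Lemma bounded_measurable_add f g : bm f -> bm g -> bm (fun x => f x + g x).
Proof.
move=> [mf [a fa]] [mg [b gb]]; split; first exact: measurable_funD.
exists (a + b) => x xD; rewrite (le_trans (ler_normD _ _))//.
by rewrite lerD ?fa ?gb.
Qed.

Lemma bounded_measurable_mul f g : bm f -> bm g -> bm (fun x => f x * g x).
Proof.
move=> [mf [a fa]] [mg [b gb]]; split; first exact: measurable_funM.
by exists (a * b) => x xD; rewrite normrM ler_pM ?fa ?gb.
Qed.

Lemma bounded_measurable_sum (Y : nat -> T -> R) n : (forall k, bm (Y k)) ->
  bm (fun x => \sum_(k < n) Y k x).
Proof.
move=> bY; elim: n => [|n IH].
  by under eq_fun do rewrite big_ord0; exact: bounded_measurable_cst.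
by under eq_fun do rewrite big_ord_recr /=; exact: bounded_measurable_add.
Qed.

Lemma expect_add f g : bm f -> bm g -> 'E_(fun x => f x + g x) = 'E_f + 'E_g.
Proof. by move=> bf bg; rewrite RintegralD//; exact: bounded_measurable_integrable. Qed.

Lemma expect_scale c f : bm f -> 'E_(fun x => c * f x) = c * 'E_f.
Proof. by move=> bf; rewrite RintegralZl//; exact: bounded_measurable_integrable. Qed.

Lemma expect_cst (c : R) : 'E_(fun=> c) = c.
Proof. by rewrite Rintegral_cst// [X in fine X](_ : _ = 1%E)//= mulr1. Qed.

Lemma expect_sum (Y : nat -> T -> R) n : (forall k, bm (Y k)) ->
  'E_(fun x => \sum_(k < n) Y k x) = \sum_(k < n) 'E_(Y k).
Proof.
move=> bY; elim: n => [|n IH].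
  by rewrite big_ord0; under eq_Rintegral do rewrite big_ord0; exact: expect_cst.
rewrite big_ord_recr/= -IH -expect_add//; last exact: bounded_measurable_sum.
by apply: eq_Rintegral => x _; rewrite big_ord_recr.
Qed.

Lemma expect_eq f g : (forall x, D x -> f x = g x) -> 'E_f = 'E_g.
Proof. by move=> fg; apply: eq_Rintegral => x /set_mem; exact: fg. Qed.

(** The sum of the series of the Z_j is integrable, hence finite almost
    everywhere. *)
Lemma ae_cvg0_of_summable (Z : nat -> T -> R) (b : R) : (forall j, bm (Z j)) ->
  (forall j x, D x -> 0 <= Z j x) ->
  (forall n, \sum_(j < n) 'E_(Z j) <= b) ->
  {ae mu, forall x, D x -> Z j x @[j --> \oo] --> 0}.
Proof.
move=> bZ Z0 Zb.
pose s x := (\sum_(j <oo) (Z j x)%:E)%E.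
have mZ j : measurable_fun D (fun x => (Z j x)%:E).
  by apply/measurable_EFinP; exact: (bZ j).1.
have Z0E j x : D x -> (0 <= (Z j x)%:E)%E by move=> xD; rewrite lee_fin Z0.
have sint : mu.-integrable D s.
  apply/integrableP; split.
    by apply: (@ge0_emeasurable_sum _ _ _ _ _ predT) => [k x xD _|k _];
      [exact: Z0E|exact: mZ].
  under eq_integral.
    move=> x /set_mem xD; rewrite gee0_abs; last first.
      by apply: nneseries_ge0 => j _ _; exact: Z0E.
    over.
  rewrite integral_nneseries//.
  apply: (@le_lt_trans _ _ b%:E); last exact: ltry.
  apply: lime_le.
    by apply: is_cvg_nneseries => j _ _; apply: integral_ge0 => x xD; exact: Z0E.
  apply: nearW => n; rewrite big_mkord.
  under eq_bigr.
    move=> j _; have Zint := bounded_measurable_integrable (bZ j).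
    rewrite -(fineK (integrable_fin_num mD Zint)).
    over.
  by rewrite sumEFin lee_fin; exact: Zb.
have := integrable_ae mD sint.
apply: filterS => x + xD => /(_ xD) sfin.
apply: cvg_series_cvg_0; apply: nondecreasing_is_cvgn.
  by apply: nondecreasing_series => j _ _; exact: Z0.
exists (fine (s x)) => _ [n _ <-].
rewrite -lee_fin fineK// /series/= -sumEFin.
by apply: nneseries_lim_ge => j _ _; exact: Z0E.
Qed.

Section almost_uncorrelated.
Variables (Y : nat -> T -> R) (C kappa : R).
Hypotheses (C0 : 0 <= C) (kappa01 : 0 < kappa < 1) (bY : forall k, bm (Y k)).
Hypothesis Y0 : forall k x, D x -> 0 <= Y k x.
(* The error is proportional to the mean of the later variable, which is what
   keeps the variance of the partial sums proportional to their mean. *)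
Hypothesis covY : forall j n,
  'E_(fun x => Y j x * Y (n + j)%N x) <=
    'E_(Y j) * 'E_(Y (n + j)%N) + C * kappa ^+ n * 'E_(Y (n + j)%N).

Let S n x := \sum_(k < n) Y k x.
Let M n := \sum_(k < n) 'E_(Y k).
(* C / (1 - kappa) once for the diagonal and twice for the off-diagonal terms *)
Let K := 3 * (C / (1 - kappa)).

Let bS n : bm (S n). Proof. exact: bounded_measurable_sum. Qed.
Let SS n x : S n.+1 x = S n x + Y n x.
Proof. by rewrite /S big_ord_recr. Qed.
Let MS n : M n.+1 = M n + 'E_(Y n).
Proof. by rewrite /M big_ord_recr. Qed.
Let eY0 k : 0 <= 'E_(Y k).
Proof. by apply: Rintegral_ge0; exact: Y0. Qed.

(** Adding Y_n to the sum costs the cross terms Y_j Y_n, whose errors form a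
    geometric series with common factor the mean of Y_n. *)
Lemma second_moment_le n : 'E_(fun x => S n x ^+ 2) <= M n ^+ 2 + K * M n.
Proof.
have /andP[k0 k1] := kappa01; have k1' : 0 < 1 - kappa by rewrite subr_gt0.
elim: n => [|n IH].
  rewrite (expect_eq (g := fun=> 0)) ?expect_cst; last first.
    by move=> x _; rewrite /S big_ord0 expr0n.
  by rewrite /M big_ord0 expr0n/= mulr0 addr0.
have -> : 'E_(fun x => S n.+1 x ^+ 2) = 'E_(fun x => S n x ^+ 2) +
    (2 * 'E_(fun x => S n x * Y n x) + 'E_(fun x => Y n x * Y n x)).
  rewrite -expect_scale -?expect_add;
    try by do ?[apply: bounded_measurable_add|apply: bounded_measurable_mul
               |exact: bounded_measurable_cst].
  by apply: expect_eq => x _; rewrite SS; ring.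
have cross : 'E_(fun x => S n x * Y n x) <= M n * 'E_(Y n) + C / (1 - kappa) * 'E_(Y n).
  rewrite (expect_eq (g := fun x => \sum_(j < n) Y j x * Y n x)); last first.
    by move=> x _; rewrite /S mulr_suml.
  rewrite (expect_sum (Y := fun j x => Y j x * Y n x)); last first.
    by move=> j; exact: bounded_measurable_mul.
  rewrite -mulrDl -[leRHS]mulrC mulrDr.
  apply: (@le_trans _ _ (\sum_(j < n)
    ('E_(Y j) * 'E_(Y n) + C * kappa ^+ (n - j) * 'E_(Y n)))).
    apply: ler_sum => j _; have := covY j (n - j).
    by rewrite subnK// ltnW.
  rewrite big_split/= -!mulr_suml -mulr_sumr mulrC lerD2l mulrC ler_wpM2l// ler_wpM2l//.
  exact: sum_geometric_le.
have diag := covY n 0; rewrite add0n expr0 mulr1 in diag.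
have CC : C * 'E_(Y n) <= C / (1 - kappa) * 'E_(Y n).
  by rewrite ler_wpM2r// ler_peMr// invf_ge1// gerBl ltW.
rewrite MS; move: IH cross diag CC; rewrite /K.
move: (C / _) (M n) ('E_(Y n)) ('E_(fun x => S n x ^+ 2))
  ('E_(fun x => S n x * Y n x)) ('E_(fun x => Y n x * Y n x)) => A mn e X Z W.
by nra.
Qed.

Lemma variance_le n : 'E_(fun x => (S n x - M n) ^+ 2) <= K * M n.
Proof.
have -> : 'E_(fun x => (S n x - M n) ^+ 2) = 'E_(fun x => S n x ^+ 2) +
    (- (2 * M n) * 'E_(S n) + M n ^+ 2).
  rewrite -expect_scale// -[X in _ + (_ + X)]expect_cst -?expect_add;
    try by do ?[exact: bS|apply: bounded_measurable_add
               |apply: bounded_measurable_mul|exact: bounded_measurable_cst].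
  by apply: expect_eq => x _; ring.
have := second_moment_le n; rewrite expect_sum// -/(M n); nra.
Qed.

(** The variance bound makes the squared relative deviations summable along the
    times n_j at which the sum of the means first reaches (j+1)^2; since single
    means are at most b, the sum of the means overshoots (j+1)^2 by at most b. *)
Lemma strong_law_slow_means (b : R) : (forall k, 'E_(Y k) <= b) ->
  M @ \oo --> +oo ->
  {ae mu, forall x, D x -> (M n)^-1 * S n x @[n --> \oo] --> (1 : R)}.
Proof.
move=> eb Moo.
have ndM : nondecreasing_seq M.
  by apply/nondecreasing_seqP => n; rewrite MS lerDl.
have /choice[n_ Hn] j : exists n, (j.+1)%:R ^+ 2 <= M n /\
    forall i, (i < n)%N -> M i < (j.+1)%:R ^+ 2.
  by have [n] := first_passage ndM Moo ((j.+1)%:R ^+ 2); exists n.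
have Mn0 j : 0 < M (n_ j) by exact: lt_le_trans (Hn j).1.
have K0 : 0 <= K.
  by have /andP[_ k1] := kappa01; rewrite /K mulr_ge0// divr_ge0// subr_ge0 ltW.
pose Z j x := ((M (n_ j))^-1 * S (n_ j) x - 1) ^+ 2.
have bZ j : bm (Z j).
  rewrite /Z; under eq_fun do rewrite expr2.
  by apply: bounded_measurable_mul;
    apply: (bounded_measurable_add _ (bounded_measurable_cst (-1)));
    apply: bounded_measurable_mul => //; exact: bounded_measurable_cst.
have EZ j : 'E_(Z j) <= K * ((j.+1)%:R ^+ 2)^-1.
  have -> : 'E_(Z j) = (M (n_ j)) ^- 2 * 'E_(fun x => (S (n_ j) x - M (n_ j)) ^+ 2).
    rewrite -expect_scale; last first.
      under eq_fun do rewrite expr2.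
      by apply: bounded_measurable_mul;
        apply: (bounded_measurable_add _ (bounded_measurable_cst _)).
    by apply: expect_eq => x _; rewrite /Z; field; rewrite gt_eqF.
  rewrite ler_pdivrMl ?exprn_gt0// (le_trans (variance_le _))//.
  rewrite expr2 mulrCA ler_wpM2l// -mulrA ler_peMr//; first exact: ltW.
  by rewrite ler_pdivlMr// mul1r (Hn j).1.
have Zb n : \sum_(j < n) 'E_(Z j) <= K * 2.
  apply: (@le_trans _ _ (\sum_(j < n) (K * ((j.+1)%:R ^+ 2)^-1))).
    by apply: ler_sum => j _; exact: EZ.
  by rewrite -mulr_sumr ler_wpM2l// sum_inv_square_le.
have := ae_cvg0_of_summable bZ (fun j x _ => sqr_ge0 _) Zb.
apply: filterS => x + xD => /(_ xD) Zx.
apply: (@ratio_interpolation _ (S ^~ x) M n_ b) => //.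
- by apply/nondecreasing_seqP => n; rewrite SS lerDl Y0.
- by move=> n; apply: sumr_ge0 => k _; exact: Y0.
- move=> j; have [jM iM] := Hn j; rewrite jM/=.
  case: (n_ j) jM iM (Mn0 j) => [|n] jM iM; first by rewrite /M big_ord0 ltxx.
  by rewrite MS lerD// ltW// iM.
- by move=> j i ij; exact: (Hn j).2.
- apply/cvgrPdist_le => e e0; move/cvgrPdist_le : Zx => /(_ _ (exprn_gt0 2 e0)).
  apply: filterS => j.
  rewrite sub0r normrN ger0_norm ?sqr_ge0// /Z -[X in X <= _]real_normK ?num_real//.
  by rewrite ler_sqr ?nnegrE ?normr_ge0 ?(ltW e0)// distrC.
Qed.

End almost_uncorrelated.
End strong_law.

(** * Functions of bounded variation *)

Section bounded_variation_algebra.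
Context {R : realType}.
Implicit Types (f g h u : R -> R) (A B : set R).

Local Notation BV := (bounded_variation 0 1).

(** The common source of the stability of bounded variation under products,
    absolute values and changes outside the unit interval. *)
Lemma variation_le_comb f g h (a b : R) s : itv_partition 0 1 s ->
  (forall x y, I01 x -> I01 y ->
    `|h x - h y| <= a * `|f x - f y| + b * `|g x - g y|) ->
  variation 0 1 h s <= a * variation 0 1 f s + b * variation 0 1 g s.
Proof.
move=> ps H; rewrite /variation !mulr_sumr -big_split/= !big_nat.
have I k : (k < (size s).+1)%N -> I01 (nth 1 (0 :: s) k).
  move=> ks; rewrite /= in_itv/= (itv_partition_nth_ge ks ps).
  by rewrite (itv_partition_nth_le ks ps).
apply: ler_sum => k /andP[_ ks]; apply: H; first exact: (I k.+1).
by apply: I; rewrite ltnS ltnW.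
Qed.

(** Using one constant for the supremum and the variations gives the product
    rule the form of a statement about single constants. *)
Definition var_bound (a : R) f :=
  (forall x, I01 x -> `|f x| <= a) /\
  (forall s, itv_partition 0 1 s -> variation 0 1 f s <= a).

Lemma norm_le_variation f b : (forall s, itv_partition 0 1 s ->
    variation 0 1 f s <= b) ->
  forall x y, I01 x -> I01 y -> `|f x - f y| <= b.
Proof.
move=> fb x y.
wlog xy : x y / x <= y => [H Ix Iy|].
  by have [xy|/ltW yx] := leP x y; [|rewrite distrC]; exact: H.
rewrite /= !in_itv/= => /andP[x0 x1] /andP[y0 y1].
have fxy : (`|f y - f x|%:E <= total_variation 0 1 f)%E.
  rewrite (total_variationD f x0 x1) (total_variationD f xy y1).
  rewrite addeCA (le_trans (total_variation_ge f xy))// leeDl//.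
  by rewrite adde_ge0// total_variation_ge0.
rewrite distrC -lee_fin (le_trans fxy)//.
by apply: ge_ereal_sup => _ [_ [s ps <-]] <-; rewrite lee_fin fb.
Qed.

Lemma var_boundBV a f : var_bound a f -> BV f.
Proof. by move=> [_ fa]; exists a => _ [s ps <-]; exact: fa. Qed.

Lemma BV_var_bound f : BV f -> exists2 a, 0 <= a & var_bound a f.
Proof.
move=> [b fb]; have fb' s : itv_partition 0 1 s -> variation 0 1 f s <= b.
  by move=> ps; apply: fb; exists s.
have b0 : 0 <= b.
  rewrite (le_trans _ (fb' [:: 1] _))//; first exact: sumr_ge0.
  exact: itv_partition1.
exists (`|f 0| + b); first by rewrite addr_ge0.
split=> [x Ix|s ps]; last by rewrite (le_trans (fb' s ps))// lerDr.
rewrite -[f x](subrK (f 0)) addrC (le_trans (ler_normD _ _))// lerD2l.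
by apply: norm_le_variation => //=; rewrite in_itv/= lexx ler01.
Qed.

Lemma var_boundM a b f g : var_bound a f -> var_bound b g ->
  var_bound (2 * (a * b)) (fun x => f x * g x).
Proof.
move=> [fa va] [gb vb].
have I0 : (I01 : set R) 0 by rewrite /= in_itv/= lexx ler01.
have a0 : 0 <= a by rewrite (le_trans _ (fa 0 I0)).
have b0 : 0 <= b by rewrite (le_trans _ (gb 0 I0)).
split=> [x Ix|s ps].
  rewrite normrM mulr_natl mulr2n (@le_trans _ _ (a * b))//.
    by apply: ler_pM => //; [exact: fa|exact: gb].
  by rewrite lerDl mulr_ge0.
rewrite (le_trans (@variation_le_comb f g _ b a s ps _))//; last first.
  have := va _ ps; have := vb _ ps => H1 H2.
  rewrite mulr_natl mulr2n; apply: lerD; last exact: ler_wpM2l.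
  by rewrite [a * b]mulrC; exact: ler_wpM2l.
move=> x y Ix Iy.
have -> : f x * g x - f y * g y = g x * (f x - f y) + f y * (g x - g y).
  by rewrite !mulrBr [g x * f x]mulrC [g x * f y]mulrC addrA subrK.
rewrite (le_trans (ler_normD _ _))// !normrM.
by apply: lerD; apply: ler_wpM2r => //; [exact: gb|exact: fa].
Qed.

Lemma var_bound_abs a f : var_bound a f -> var_bound a (fun x => `|f x|).
Proof.
move=> [fa va]; split=> [x xI|s ps]; first by rewrite normr_id fa.
rewrite (le_trans (@variation_le_comb f f _ 1 0 s ps _))//; last first.
  by rewrite mul1r mul0r addr0; exact: va.
by move=> x y _ _; rewrite mul1r mul0r addr0 ler_dist_dist.
Qed.

Lemma BV_mul f g : BV f -> BV g -> BV (fun x => f x * g x).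
Proof.
move=> /BV_var_bound[a _ fa] /BV_var_bound[b _ gb].
exact: var_boundBV (var_boundM fa gb).
Qed.

Lemma BV_sub f g : BV f -> BV g -> BV (fun x => f x - g x).
Proof.
by move=> bf bg; apply: bounded_variationD => //; exact: bounded_variationN.
Qed.

Lemma BV_add f g : BV f -> BV g -> BV (fun x => f x + g x).
Proof. exact: bounded_variationD. Qed.

Lemma BV_ext f g : (forall x, I01 x -> f x = g x) -> BV f -> BV g.
Proof.
move=> fg /BV_var_bound[a _ [_ fa]]; exists a => _ [s ps <-].
rewrite (le_trans _ (fa s ps))// (le_trans (@variation_le_comb f f g 1 0 s ps _))//.
  by move=> x y Ix Iy; rewrite !fg// mul1r mul0r addr0.
by rewrite mul1r mul0r addr0.
Qed.

Lemma BV_nondecreasing f : {in (I01 : set R) &, nondecreasing_fun f} -> BV f.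
Proof.
move=> ndf; apply: nondecreasing_bounded_variation => x y xI yI xy.
by apply: ndf; rewrite ?inE.
Qed.

Lemma BV_cst (c : R) : BV (fun=> c).
Proof. by apply: BV_nondecreasing => x y. Qed.

Lemma BV_id : BV (@id R).
Proof. by apply: BV_nondecreasing => x y. Qed.

(** By the Jordan decomposition, a property that passes to differences only has
    to be checked on nondecreasing functions. *)
Lemma BV_ind (P : (R -> R) -> Prop) :
  (forall f g, (forall x, I01 x -> f x = g x) -> P f -> P g) ->
  (forall f g, BV f -> BV g -> P f -> P g -> P (fun x => f x - g x)) ->
  (forall f, {in (I01 : set R) &, nondecreasing_fun f} -> P f) ->
  forall f, BV f -> P f.
Proof.
move=> Pext Psub Pnd f bf.
have nd g : BV g -> {in (I01 : set R) &, nondecreasing_fun (fine \o neg_tv 0 g)}.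
  move=> bg x y /set_mem xI /set_mem yI xy.
  have fin z : I01 z -> neg_tv 0 g z \is a fin_num.
    rewrite /= in_itv/= => /andP[z0 z1].
    rewrite /neg_tv fin_numM// fin_numB/= andbT.
    exact/(bounded_variationP _ z0)/(bounded_variationl z0 z1).
  apply: fine_le; rewrite ?fin//.
  by apply: (@neg_tv_nondecreasing _ 0 1).
have bNf : BV (\- f) by exact: bounded_variationN.
apply: (Pext _ _ (fun x xI => esym (bounded_variation_pos_neg_tvE bf xI))).
by apply: Psub; try apply: Pnd; try apply: BV_nondecreasing; exact: nd.
Qed.

Lemma BV_measurable f : BV f -> measurable_fun (I01 : set R) f.
Proof.
move: f; apply: BV_ind => [f g fg mf|f g _ _|f ndf].
- by apply: eq_measurable_fun mf => x /set_mem; exact: fg.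
- by move=> mf mg; exact: measurable_funD mf (measurable_funN mg).
- pose h x := if x < 0 then f 0 else if x <= 1 then f x else f 1.
  apply: (@eq_measurable_fun _ _ _ _ _ h).
    move=> x /set_mem; rewrite /= in_itv/= /h => /andP[x0 x1].
    by rewrite ltNge x0/= x1.
  have ndI x y : 0 <= x -> x <= y -> y <= 1 -> f x <= f y.
    move=> x0 xy y1; apply: ndf => //; rewrite inE/= in_itv/= ?x0 ?y1 ?andbT.
      exact: le_trans y1.
    exact: le_trans xy.
  apply: nondecreasing_measurable => // x y xy; rewrite /h.
  case: (ltP x 0) => x0; case: (ltP y 0) => y0 //.
  - by case: ifPn => y1; exact: ndI.
  - by move: (le_lt_trans (le_trans x0 xy) y0); rewrite ltxx.
  - case: (leP x 1) => x1; case: (leP y 1) => y1 //; try exact: ndI.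
    by move: (le_lt_trans (le_trans xy y1) x1); rewrite ltxx.
Qed.

(** A function u that is nondecreasing on A and bounded by b extends to a
    nondecreasing function equal to - b to the left of A and to b to its right.
    Extending 0 in the same way and subtracting leaves u on A and 0 elsewhere. *)
Lemma BV_patch_nondecreasing A u (b : R) : is_interval A ->
  {in A &, nondecreasing_fun u} -> (forall x, A x -> `|u x| <= b) ->
  0 <= b -> BV (u \_ A).
Proof.
move=> iA ndu ub b0.
pose above x := `[< exists2 a, A a & a <= x >].
pose ext (v : R -> R) x := if x \in A then v x else if above x then b else - b.
have ext_nd v : {in A &, nondecreasing_fun v} -> (forall x, A x -> `|v x| <= b) ->
    nondecreasing_fun (ext v).
  move=> ndv vb x y xy; rewrite /ext.
  have [xA|xA] := boolP (x \in A); have [yA|yA] := boolP (y \in A).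
  - exact: ndv.
  - rewrite ifT ?(le_trans (ler_norm _) (vb _ (set_mem xA)))//.
    by apply/asboolP; exists x => //; exact: set_mem.
  - rewrite ifF; first by have := vb _ (set_mem yA); rewrite ler_norml => /andP[].
    apply/asboolP => -[a Aa ax]; move: xA => /negP; apply; apply/mem_set.
    by apply: (iA a y) => //; [exact: set_mem|rewrite ax].
  - have [xa|xa] := boolP (above x); have [ya|ya] := boolP (above y) => //; first last.
      by rewrite (@le_trans _ _ 0)// oppr_le0.
    case/negP: ya; apply/asboolP; move/asboolP: xa => -[a Aa ax].
    by exists a => //; exact: le_trans xy.
apply: (@BV_ext (fun x => ext u x - ext (fun=> 0) x)).
  by move=> x _; rewrite /ext patchE; case: ifPn; rewrite ?subr0// subrr.
apply: BV_sub; apply: BV_nondecreasing => x y _ _; apply: ext_nd => //.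
by move=> z _; rewrite normr0.
Qed.

Lemma BV_patch_nonincreasing A u (b : R) : is_interval A ->
  {in A &, nonincreasing_fun u} -> (forall x, A x -> `|u x| <= b) ->
  0 <= b -> BV (u \_ A).
Proof.
move=> iA niu ub b0.
apply: (@BV_ext (\- ((\- u) \_ A))).
  by move=> x _ /=; rewrite !patchE; case: ifPn => _; rewrite ?opprK ?oppr0.
apply/bounded_variationN/(BV_patch_nondecreasing (b := b)) => //.
  by move=> x y xA yA xy; rewrite lerN2; exact: niu.
by move=> x Ax /=; rewrite normrN; exact: ub.
Qed.

End bounded_variation_algebra.

(** * Transfer along piecewise monotone maps *)

Section piecewise_monotone_maps.
Context {R : realType}.
Implicit Types (f g h u : R -> R) (A B : set R).

Local Notation BV := (bounded_variation 0 1).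

(** An interval is the disjoint union of the open pieces of a partition and of
    its finitely many points. *)
Lemma itv_partition_ind (P : set R -> Prop) (a b : R) s :
  (forall A B, A `&` B = set0 -> P A -> P B -> P (A `|` B)) ->
  (forall c, a <= c <= b -> P [set c]) ->
  itv_partition a b s ->
  (forall i, (i < size s)%N ->
    P `]nth 0 (a :: s) i, nth 0 (a :: s) i.+1[%classic) ->
  P `[a, b]%classic.
Proof.
move=> PU; elim: s a => [|c s IH] a P1 ps Poo.
  by rewrite (itv_partition_nil ps) set_itv1; apply: P1;
    rewrite lexx -(itv_partition_nil ps) lexx.
have ac : a < c by case: ps => /= /andP[].
have cb : c <= b := itv_partition_le (itv_partition_cons ps).
have -> : `[a, b]%classic = [set a] `|` (`]a, c[%classic `|` `[c, b]%classic).
  apply/seteqP; split => [x|x [->|[]]]; rewrite /= !in_itv/=.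
  - move=> /andP[]; rewrite le_eqVlt => /predU1P[->|ax] xb; [by left|right].
    by have [xc|cx] := ltP x c; [left; rewrite ax|right].
  - by rewrite lexx (le_trans (ltW ac)).
  - by move=> /andP[ax xc]; rewrite (ltW ax) (le_trans (ltW xc)).
  - by move=> /andP[cx ->]; rewrite (le_trans (ltW ac)).
apply: (PU).
- apply/seteqP; split => // x [/= ->]; rewrite /= !in_itv/= ltxx/=.
  by rewrite [c <= a]leNgt ac/= => -[].
- by apply: P1; rewrite lexx (le_trans (ltW ac)).
apply: (PU).
- apply/seteqP; split => // x []; rewrite /= !in_itv/= => /andP[_ xc] /andP[cx _].
  by move: (lt_le_trans xc cx); rewrite ltxx.
- exact: (Poo 0%N).
- apply: IH => [d /andP[cd db]||i si].
  + by apply: P1; rewrite db (le_trans (ltW ac)).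
  + exact: itv_partition_cons ps.
  + exact: (Poo i.+1).
Qed.

(** The transfer operator of t with constant weight 1, restricted to the
    preimages in B; a weight is absorbed into f. *)
Definition fibre_sum (t : R -> R) B f x := \sum_(y \in B `&` t @^-1` [set x]) f y.

(** What the transfer operator needs from a monotonicity branch B of t.  These
    properties pass to disjoint unions, so they hold on the unit interval as
    soon as they hold for branches and for points. *)
Definition BV_piece (t : R -> R) B :=
  [/\ B `<=` I01, forall x, finite_set (B `&` t @^-1` [set x]),
      forall f, BV f -> BV ((f \o t) \_ B)
    & forall f, BV f -> BV (fibre_sum t B f)].

Lemma BV_pieceU t A B : A `&` B = set0 -> BV_piece t A -> BV_piece t B ->
  BV_piece t (A `|` B).
Proof.
move=> AB0 [A1 finA compA sumA] [B1 finB compB sumB]; split.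
- by move=> x [/A1|/B1].
- by move=> x; rewrite setIUl finite_setU.
- move=> f bf; apply: BV_ext (BV_add (compA _ bf) (compB _ bf)) => x _.
  rewrite !patchE in_setU.
  have [xA|xA] := boolP (x \in A); have [xB|xB] := boolP (x \in B);
    rewrite ?addr0 ?add0r//.
  have : (A `&` B) x by split; exact: set_mem.
  by rewrite AB0.
- move=> f bf; apply: BV_ext (BV_add (sumA _ bf) (sumB _ bf)) => x _.
  rewrite /fibre_sum setIUl fsbigU0//.
  by move=> y [[Ay _] [By _]]; rewrite -AB0.
Qed.

Lemma fibre_sum_patch t B f : fibre_sum t B f = fibre_sum t B f \_ (t @` B).
Proof.
apply/funext => x; rewrite patchE; case: ifPn => // xB.
rewrite /fibre_sum (_ : _ `&` _ = set0) ?fsbig_set0//.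
apply/seteqP; split => // y [By ty]; move: xB => /negP; apply.
by apply/mem_set; exists y.
Qed.

Lemma fibre_sum_inj (t : R -> R) B f y : {in B &, injective t} -> B y ->
  fibre_sum t B f (t y) = f y.
Proof.
move=> injt By; rewrite /fibre_sum (_ : _ `&` _ = [set y]) ?fsbig_set1//.
apply/seteqP; split => [z [Bz /= tz]|z -> //].
by apply: injt => //; exact: mem_set.
Qed.

Lemma injective_finite_fibre (t : R -> R) B x : {in B &, injective t} ->
  finite_set (B `&` t @^-1` [set x]).
Proof.
move=> injt; have [[y [By <-]]|no] := pselect (exists y, B y /\ t y = x).
  apply: (sub_finite_set _ (finite_set1 y)) => z [Bz /= tz].
  by apply: injt => //; exact: mem_set.
rewrite (_ : _ `&` _ = set0)//; apply/seteqP; split => // y [By ty].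
by apply: no; exists y.
Qed.

Lemma fibre_sumB (t : R -> R) B f g x : finite_set (B `&` t @^-1` [set x]) ->
  fibre_sum t B (fun x => f x - g x) x = fibre_sum t B f x - fibre_sum t B g x.
Proof.
by move=> fin; rewrite /fibre_sum !fsbig_finite//= sumrB.
Qed.

(** For nondecreasing f, both f o t on B and f o (t restricted to B)^-1 on t @` B
    are monotone, and they live on intervals. *)
Lemma BV_piece_mono (t : R -> R) B : (forall x, I01 x -> I01 (t x)) -> B `<=` I01 ->
  is_interval B -> is_interval (t @` B) ->
  {in B &, {mono t : x y / x < y}} \/ {in B &, {mono t : x y /~ x < y}} ->
  BV_piece t B.
Proof.
move=> t01 B1 iB itB tmono.
have injt : {in B &, injective t}.
  move=> x y xB yB txy; apply/eqP; rewrite eq_le !leNgt.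
  by case: tmono => tm; rewrite -(tm x y)// -(tm y x)// txy ltxx.
split => //.
- by move=> x; exact: injective_finite_fibre.
- apply: BV_ind => [f g fg|f g bf bg|f ndf].
  + apply: BV_ext => x _; rewrite !patchE; case: ifPn => // /set_mem/B1/t01.
    exact: fg.
  + move=> pf pg; apply: BV_ext (BV_sub pf pg) => x _.
    by rewrite !patchE; case: ifPn; rewrite // subr0.
  + have [b b0 [fb _]] := BV_var_bound (BV_nondecreasing ndf).
    case: tmono => tm; [apply: (BV_patch_nondecreasing (b := b))
      | apply: (BV_patch_nonincreasing (b := b))] => //.
    2, 4: by move=> x /B1/t01; exact: fb.
    * move=> x y xB yB xy /=; apply: ndf; try (apply/mem_set/t01/B1; exact: set_mem).
      by rewrite leNgt tm// -leNgt.
    * move=> x y xB yB xy /=; apply: ndf; try (apply/mem_set/t01/B1; exact: set_mem).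
      by rewrite leNgt tm// -leNgt.
- apply: BV_ind => [f g fg|f g bf bg|f ndf].
  + apply: BV_ext => x _; apply: eq_fsbigr => y /set_mem[/B1 By _]; exact: fg.
  + move=> pf pg; apply: BV_ext (BV_sub pf pg) => x _.
    by rewrite fibre_sumB//; exact: injective_finite_fibre.
  + have [b b0 [fb _]] := BV_var_bound (BV_nondecreasing ndf).
    rewrite fibre_sum_patch.
    case: tmono => tm; [apply: (BV_patch_nondecreasing (b := b))
      | apply: (BV_patch_nonincreasing (b := b))] => //.
    2, 4: by move=> _ [x Bx <-]; rewrite fibre_sum_inj//; apply/fb/B1.
    * move=> _ _ /set_mem[x Bx <-] /set_mem[y By <-] xy.
      rewrite !fibre_sum_inj//; apply: ndf; try (apply/mem_set/B1 => //).
      by rewrite leNgt -tm ?inE// -leNgt.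
    * move=> _ _ /set_mem[x Bx <-] /set_mem[y By <-] xy.
      rewrite !fibre_sum_inj//; apply: ndf; try (apply/mem_set/B1 => //).
      by rewrite leNgt -tm ?inE// -leNgt.
Qed.

Lemma BV_piece01 t : (forall x, I01 x -> I01 (t x)) -> piecewise_monotone t ->
  BV_piece t I01.
Proof.
move=> t01 [s [ps pm]]; apply: (itv_partition_ind (s := s)) => //.
- exact: BV_pieceU.
- move=> c c01; apply: BV_piece_mono => //.
  + by move=> _ -> /=; rewrite in_itv.
  + by move=> x y /= -> -> z; rewrite -eq_le => /eqP.
  + by rewrite image_set1 => x y /= -> -> z; rewrite -eq_le => /eqP.
  + by left => x y /set_mem -> /set_mem ->; rewrite !ltxx.
- move=> i si; have /= [tm tc] := pm i si.
  have nthI j : (j < (size s).+1)%N -> (I01 : set R) (nth 0 (0 :: s) j).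
    move=> js; rewrite (set_nth_default 1)//= in_itv/=.
    by rewrite (itv_partition_nth_ge js ps) (itv_partition_nth_le js ps).
  apply: BV_piece_mono => //.
  + move=> x; rewrite /= !in_itv/= => /andP[ax xb].
    have := nthI i; have := nthI i.+1; rewrite /= !in_itv/=.
    move=> /(_ si)/andP[_ b1] /(_ (ltnW si))/andP[a0 _].
    by rewrite (le_trans a0 (ltW ax)) (le_trans (ltW xb) b1).
  + exact: interval_is_interval.
  + apply/connected_intervalP/connected_continuous_connected.
      exact/connected_intervalP/interval_is_interval.
    by apply: continuous_in_subspaceT => x /set_mem; exact: tc.
  + by case: tm => tm; [left|right] => x y xJ yJ; apply: tm; exact: set_mem.
Qed.

Section surjective.
Variable t : R -> R.
Hypotheses (t01 : forall x, I01 x -> I01 (t x)) (tpm : piecewise_monotone t).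

Lemma BV_comp f : BV f -> BV (f \o t).
Proof.
have [_ _ + _] := BV_piece01 t01 tpm => /[apply].
by apply: BV_ext => x xI; rewrite patchE mem_set.
Qed.

Lemma BV_fibre_sum f : BV f -> BV (fibre_sum t I01 f).
Proof. by have [_ _ _] := BV_piece01 t01 tpm; apply. Qed.

End surjective.

End piecewise_monotone_maps.

(** * Integration over the unit interval *)

Section integration_on_unit_interval.
Context {R : realType} (nu : {measure set R -> \bar R}).
Hypothesis nu1 : nu I01 = 1%E.
Implicit Types (f g h u : R -> R).

Local Notation BV := (bounded_variation 0 1).

Lemma BV_bounded_measurable f : BV f -> bounded_measurable (I01 : set R) f.
Proof.
move=> bf; have [a _ [fa _]] := BV_var_bound bf.
by split; [exact: BV_measurable|exists a].
Qed.

Lemma BV_integrable f : BV f -> nu.-integrable I01 (EFin \o f).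
Proof. by move=> /BV_bounded_measurable; exact: bounded_measurable_integrable. Qed.

Lemma BV_mean f : BV f -> (\int[nu]_(x in I01) (f x)%:E)%E = (mean nu f)%:E.
Proof. by move=> bf; rewrite fineK//; exact: integrable_fin_num (BV_integrable bf). Qed.

Lemma mean_sub f g : BV f -> BV g ->
  mean nu (fun x => f x - g x) = mean nu f - mean nu g.
Proof. by move=> bf bg; rewrite /mean RintegralB//; exact: BV_integrable. Qed.

Lemma mean_scale a f : BV f -> mean nu (fun x => a * f x) = a * mean nu f.
Proof. by move=> bf; rewrite /mean RintegralZl//; exact: BV_integrable. Qed.

Lemma mean_eq f g : (forall x, I01 x -> f x = g x) -> mean nu f = mean nu g.
Proof. by move=> fg; apply: eq_Rintegral => x /set_mem; exact: fg. Qed.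

Lemma mean_ae_eq f g :
  measurable_fun (I01 : set R) f -> measurable_fun (I01 : set R) g ->
  {ae nu, forall x, I01 x -> f x = g x} -> mean nu f = mean nu g.
Proof.
move=> mf mg fg; congr fine; apply: ae_eq_integral => //.
- exact/measurable_EFinP.
- exact/measurable_EFinP.
- by apply: filterS fg => x + xI => ->.
Qed.

Lemma mean_cst (c : R) : mean nu (fun=> c) = c.
Proof. exact: expect_cst. Qed.

Lemma mean_le f g : BV f -> BV g -> (forall x, I01 x -> f x <= g x) ->
  mean nu f <= mean nu g.
Proof. by move=> bf bg fg; apply: le_Rintegral => //; exact: BV_integrable. Qed.

Lemma mean_le_ae f g : BV f -> BV g -> {ae nu, forall x, I01 x -> f x <= g x} ->
  mean nu f <= mean nu g.
Proof.
move=> bf bg fg.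
(* min (f, g) is almost everywhere equal to f and everywhere at most g *)
pose h x := Num.min (f x) (g x).
have mh : measurable_fun (I01 : set R) h.
  by apply: measurable_minr; exact: BV_measurable.
rewrite (@mean_ae_eq f h)//; last 2 first.
- exact: BV_measurable.
- by apply: filterS fg => x + xI => /(_ xI) fgx; rewrite /h min_l.
apply: le_Rintegral => //; last by move=> x xI; rewrite /h ge_min lexx orbT.
- apply: bounded_measurable_integrable => //; split => //.
  have [a _ [fa _]] := BV_var_bound bf; have [b _ [gb _]] := BV_var_bound bg.
  exists (a + b) => x xI; have := fa _ xI; have := gb _ xI; rewrite /h.
  by rewrite /Num.min; case: ifP => _ H1 H2; rewrite (le_trans _ (lerD H2 H1))//;
   [rewrite lerDl|rewrite lerDr].
- exact: BV_integrable.
Qed.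

Lemma L1norm_var_bound a f : var_bound a f -> (L1norm nu f <= a%:E)%E.
Proof.
move=> fa; have bf := var_boundBV fa.
have baf : BV (fun x => `|f x|) by exact: var_boundBV (var_bound_abs fa).
rewrite /L1norm (BV_mean baf) lee_fin -[leRHS]mean_cst.
by apply: mean_le => //; [exact: BV_cst|exact: fa.1].
Qed.

Lemma Bnorm_var_bound a f : var_bound a f -> (Bnorm nu f <= (2 * a)%:E)%E.
Proof.
move=> fa; rewrite mulrDl mul1r EFinD leeD//; last exact: L1norm_var_bound.
apply: (@le_trans _ _ (total_variation 0 1 f)).
  by apply: ereal_inf_lbound; exists f => //; exact: aeW.
by apply: ge_ereal_sup => _ [_ [s ps <-] <-]; rewrite lee_fin; exact: fa.2.
Qed.

Lemma class_var_ge0 f : (0 <= class_var nu f)%E.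
Proof. by apply: le_ereal_inf_tmp => _ [g _ <-]; exact: total_variation_ge0. Qed.

(** The infimum defining the variation of the class is attained up to the slack
    in the strict inequality.  A function g of variation V satisfies
    |g x| <= |g y| + V, and averaging over y bounds |g| everywhere by the sum of
    its L^1 norm and V. *)
Lemma Bnorm_representative f b :
  measurable_fun (I01 : set R) f -> (Bnorm nu f < b%:E)%E ->
  exists2 g, var_bound b g & {ae nu, forall x, I01 x -> f x = g x}.
Proof.
move=> mf fb.
have L0 : (0 <= L1norm nu f)%E by exact: integral_ge0.
have Lfin : L1norm nu f \is a fin_num.
  rewrite ge0_fin_numE// (@lt_trans _ _ b%:E)// ?ltry//.
  by rewrite (le_lt_trans _ fb)// leeDr// class_var_ge0.
have : (class_var nu f < b%:E - L1norm nu f)%E by rewrite lteBrDr.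
move=> /ereal_inf_lt[_ [g fg <-] gb].
have TV0 := total_variation_ge0 g ler01.
have TVfin : total_variation 0 1 g \is a fin_num.
  by rewrite ge0_fin_numE// (lt_trans gb)// -(fineK Lfin) ltry.
have bg : BV g by apply/bounded_variationP.
set L := fine (L1norm nu f); set V := fine (total_variation 0 1 g).
have LVb : V + L < b.
  by rewrite -lte_fin EFinD !fineK// -lteBrDr.
have varV s : itv_partition 0 1 s -> variation 0 1 g s <= V.
  move=> ps; rewrite -lee_fin fineK//; apply: ereal_sup_ubound.
  by exists (variation 0 1 g s) => //; exact: variations_variation.
have V0 : 0 <= V by rewrite fine_ge0.
have L0' : 0 <= L by rewrite fine_ge0.
exists g => //; split=> [x xI|s ps]; last first.
  by rewrite (le_trans (varV _ ps))// (le_trans _ (ltW LVb))// lerDl.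
have bag : BV (fun x => `|g x|).
  by have [a _ ga] := BV_var_bound bg; exact: var_boundBV (var_bound_abs ga).
have -> : `|g x| = mean nu (fun=> `|g x|) by rewrite mean_cst.
rewrite (@le_trans _ _ (mean nu (fun y => `|g y| + V)))//.
  apply: mean_le; [exact: BV_cst|exact: BV_add bag (BV_cst V)|].
  move=> y yI; rewrite -[g x](subrK (g y)) addrC.
  rewrite (le_trans (ler_normD _ _))// lerD2l.
  exact: norm_le_variation varV _ _ xI yI.
rewrite /mean RintegralD//; [|exact: BV_integrable|exact: BV_integrable (BV_cst V)].
rewrite -/(mean nu (fun=> V)) mean_cst addrC (le_trans _ (ltW LVb))// lerD2l.
rewrite le_eqVlt; apply/orP; left; apply/eqP.
apply: (@mean_ae_eq (fun x => `|g x|) (fun x => `|f x|)).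
- exact: BV_measurable.
- exact: measurableT_comp.
- by apply: filterS fg => y + yI => ->.
Qed.

(** The norm of B dominates the supremum norm modulo null sets. *)
Lemma ae_le_Bnorm f b : measurable_fun (I01 : set R) f -> (Bnorm nu f < b%:E)%E ->
  {ae nu, forall x, I01 x -> `|f x| <= b}.
Proof.
move=> mf /(Bnorm_representative mf)[g gb]; apply: filterS => x fg xI.
by rewrite fg//; exact: gb.1.
Qed.

End integration_on_unit_interval.

(** * Measures with a density *)

Section density.
Local Open Scope ereal_scope.
Context d (T : measurableType d) (R : realType).
Variables (mu nu : {measure set T -> \bar R}) (D : set T) (p : T -> R).
Hypotheses (mD : measurable D) (mp : measurable_fun D p)
  (p0 : forall x, D x -> (0 <= p x)%R)
  (mup : forall A, measurable A -> mu A = \int[nu]_(x in A `&` D) (p x)%:E).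

Import HBNNSimple.

(** Both sides agree on simple functions and pass to increasing limits. *)
Lemma ge0_integral_density (f : T -> \bar R) : measurable_fun D f ->
  (forall x, D x -> 0 <= f x) ->
  \int[mu]_(x in D) f x = \int[nu]_(x in D) (f x * (p x)%:E).
Proof.
move=> mf f0; pose f_ := nnsfun_approx mD mf.
have mf_ n : measurable_fun D (EFin \o f_ n).
  by apply/measurable_EFinP; exact: measurable_funTS.
have mpE : measurable_fun D (EFin \o p) by exact/measurable_EFinP.
have f_cvg x : D x -> (f_ n x)%:E @[n --> \oo] --> f x.
  by move=> Dx; exact: cvg_nnsfun_approx.
have nd_f x m n : (m <= n)%N -> (f_ m x <= f_ n x)%R.
  by move=> mn; exact/lefP/nd_nnsfun_approx.
transitivity (limn (fun n => \int[mu]_(x in D) (f_ n x)%:E)).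
  rewrite -monotone_convergence//.
  - by apply: eq_integral => x /set_mem xD; apply/esym/cvg_lim => //; exact: f_cvg.
  - by move=> n x _; rewrite lee_fin.
  - by move=> x _ m n mn; rewrite lee_fin nd_f.
transitivity (limn (fun n => \int[nu]_(x in D) ((f_ n x)%:E * (p x)%:E))); last first.
  rewrite -monotone_convergence//.
  - apply: eq_integral => x /set_mem xD; apply/cvg_lim => //.
    by apply: cvgeZr; rewrite //; apply: f_cvg.
  - by move=> n; apply: emeasurable_funM; [exact: mf_|exact: mpE].
  - by move=> n x xD; rewrite mule_ge0// lee_fin// p0.
  - by move=> x xD m n mn; rewrite lee_wpmul2r// lee_fin ?p0// nd_f.
congr (limn _); apply/funext => n.
have mfn r : measurable (f_ n @^-1` [set r]) by [].
transitivity (\sum_(k \in range (f_ n))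
    \int[mu]_(x in D) (k * \1_(f_ n @^-1` [set k]) x)%:E).
  under eq_integral do rewrite fimfunE -fsumEFin//.
  rewrite ge0_integral_fsum//.
  - by move=> y; exact/measurable_EFinP/measurable_funM.
  - by move=> y x _; rewrite nnfun_muleindic_ge0.
transitivity (\sum_(k \in range (f_ n))
    \int[nu]_(x in D) ((k * \1_(f_ n @^-1` [set k]) x)%:E * (p x)%:E)); last first.
  rewrite -ge0_integral_fsum//.
  - apply: eq_integral => x /set_mem xD.
    by rewrite -ge0_mule_fsuml ?fsumEFin -?fimfunE// => k; rewrite nnfun_muleindic_ge0.
  - move=> y; apply: emeasurable_funM => //.
    exact/measurable_EFinP/measurable_funM.
  - by move=> y x xD; rewrite mule_ge0 ?nnfun_muleindic_ge0// lee_fin p0.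
apply: eq_fsbigr => k /set_mem[x _ <-].
rewrite integralZl_indic_nnsfun// integral_indic// mup; last exact: measurableI.
under [in RHS]eq_integral do rewrite EFinM -muleA.
rewrite ge0_integralZl_EFin//; last 2 first.
- by move=> y yD; rewrite mule_ge0// lee_fin// p0.
- by apply: emeasurable_funM => //; exact/measurable_EFinP.
congr (_ * _).
rewrite -setIA setIid setIC integral_mkcondr; apply: eq_integral => y _.
by rewrite patchE indicE; case: ifPn; rewrite ?mul1e ?mul0e.
Qed.

End density.

(** * The quenched cocycle *)

Section quenched_cocycle.
Context d (Omega : topMeasurableType d) (R : realType).
Variables (m : probability Omega R) (S : random_map Omega R).
Hypothesis cs : closed_system m S.
Implicit Types (w : Omega) (f : R -> R).

Local Notation BV := (bounded_variation 0 1).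
Local Notation orb := (orb S).
Local Notation Tn := (Tn S).
Local Notation nu := (rm_nu S).
Local Notation mu := (rm_mu S).
Local Notation phi := (rm_phi S).

Lemma orbD n k w : orb (n + k) w = orb n (orb k w).
Proof. exact: iterD. Qed.

Lemma TnD n k w x : Tn (n + k) w x = Tn n (orb k w) (Tn k w x).
Proof. by elim: n => //= n IH; rewrite IH orbD. Qed.

Lemma T01 w x : I01 x -> I01 (rm_T S w x).
Proof. by move=> xI; rewrite -(cs_surj cs w); exists x. Qed.

Lemma Tn01 n w x : I01 x -> I01 (Tn n w x).
Proof. by move=> xI; elim: n => //= n IH; exact: T01. Qed.

Lemma BV_compT w f : BV f -> BV (f \o rm_T S w).
Proof. by apply: BV_comp; [exact: T01|exact: (cs_monotone cs)]. Qed.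

Lemma BV_compTn n w f : BV f -> BV (f \o Tn n w).
Proof. by elim: n f => //= n IH f bf; apply: (IH (f \o _)); exact: BV_compT. Qed.

Lemma BV_ntransfer w f : BV f -> BV (ntransfer S w f).
Proof.
move=> bf; apply: BV_mul; first exact: BV_cst.
apply: (@BV_fibre_sum _ (rm_T S w) _ _ (fun x => rm_g S w x * f x)).
- exact: T01.
- exact: (cs_monotone cs).
- exact: BV_mul (cs_g_BV cs w) bf.
Qed.

Lemma BV_ntransfern n w f : BV f -> BV (ntransfern S n w f).
Proof. by move=> bf; elim: n => //= n IH; exact: BV_ntransfer. Qed.

(** On the fibre over x, the function f o T is constantly f x, so it can be
    taken out of the sum. *)
Lemma mul_ntransfer w f h x : I01 x ->
  f x * ntransfer S w h x =
    transfer S w (fun y => (rm_lambda S w)^-1 * (f (rm_T S w y) * h y)) x.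
Proof.
move=> xI; rewrite /ntransfer /transfer mulrCA mulr_fsumr mulr_fsumr.
by apply: eq_fsbigr => y /set_mem[_ /= ->]; ring.
Qed.

Definition conformal_along w := forall k f, BV f ->
  mean (nu (orb k.+1 w)) (transfer S (orb k w) f) =
    rm_lambda S (orb k w) * mean (nu (orb k w)) f.

(** Iterate mul_ntransfer and conformality.  Both need bounded variation at
    every step, which is why f and h are taken in that class. *)
Lemma ntransfern_duality w : conformal_along w -> forall n f h, BV f -> BV h ->
  mean (nu (orb n w)) (fun x => f x * ntransfern S n w h x) =
  mean (nu w) (fun x => f (Tn n w x) * h x).
Proof.
move=> conf; elim=> // n IH f h bf bh /=.
have bL := BV_ntransfern n w bh.
have bfT := BV_compT (orb n w) bf.
rewrite -[RHS](IH (f \o rm_T S (orb n w)) h)//.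
rewrite (mean_eq _ (mul_ntransfer (orb n w) f (ntransfern S n w h))).
rewrite conf; last by apply: BV_mul (BV_cst _) _; exact: BV_mul.
rewrite mean_scale; [|exact: cs_nu_carrier cs _|exact: BV_mul].
by rewrite mulrA mulfV ?mul1r// gt_eqF// (cs_lambda_gt0 cs).
Qed.

Definition equivariant_along w := forall k (A : set R), measurable A ->
  mu (orb k.+1 w) A = mu (orb k w) (I01 `&` rm_T S (orb k w) @^-1` A).

Lemma measurable_T w : measurable_fun (I01 : set R) (rm_T S w).
Proof. exact: BV_measurable (BV_compT w (BV_id)). Qed.

Lemma ae_equivariant w (P : R -> Prop) : equivariant_along w ->
  forall k, {ae mu (orb k w), forall x, I01 x -> P x} ->
  {ae mu w, forall x, I01 x -> P (Tn k w x)}.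
Proof.
move=> eqv k; elim: k P => // k IH P [N [mN N0 PN]] /=.
apply: (IH (fun x => P (rm_T S (orb k w) x))).
exists (I01 `&` rm_T S (orb k w) @^-1` N); split.
- exact: measurable_T.
- by rewrite -[LHS](eqv k N mN).
- move=> x /= /not_implyP[xI nP]; split => //; apply: PN => /=.
  by apply/not_implyP; split => //; exact: T01.
Qed.

Lemma mean_equivariant w : equivariant_along w -> (forall k, mu (orb k w) I01 = 1%E) ->
  forall k f, BV f -> (forall x, I01 x -> 0 <= f x) ->
  mean (mu (orb k w)) f = mean (mu w) (fun x => f (Tn k w x)).
Proof.
move=> eqv mu1; elim=> // k IH f bf f0 /=.
rewrite -(IH (f \o rm_T S (orb k w))); last 2 first.
- exact: BV_compT.
- by move=> x xI; apply/f0/T01.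
set t := rm_T S (orb k w).
(* t extended by 2 outside the unit interval: the preimage of a subset A of the
   unit interval is then exactly what equivariance measures *)
pose t' x := ((fun y => t y - 2) \_ I01) x + 2.
have t'I x : I01 x -> t' x = t x by move=> xI; rewrite /t' patchE mem_set// subrK.
have t'nI x : ~ I01 x -> ~ I01 (t' x).
  move=> xI; rewrite /t' patchE memNset// add0r /= in_itv/= => /andP[_].
  by rewrite leNgt ltr1n.
have mt' : measurable_fun setT t'.
  apply: measurable_funD => //; apply/(measurable_restrictT _ _).1 => //.
  by apply: measurable_funB => //; exact: measurable_T.
have t'_pre (A : set R) : A `<=` I01 -> t' @^-1` A = I01 `&` t @^-1` A.
  move=> AI; apply/seteqP; split => x /=; last by case=> xI; rewrite t'I.
  have [xI|xI] := pselect (I01 x); first by rewrite t'I.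
  by move/AI => /(t'nI _ xI).
congr fine; rewrite -[RHS]/(\int[mu (orb k w)]_(x in I01) (f (t x))%:E)%E.
transitivity (\int[pushforward (mu (orb k w)) t']_(x in I01) (f x)%:E)%E.
  by apply: eq_measure_integral => A mA AI;
    rewrite -[RHS]/(mu (orb k w) (t' @^-1` A)) t'_pre//; exact: eqv.
rewrite ge0_integral_pushforward//; last 2 first.
- by apply/measurable_EFinP; exact: BV_measurable.
- by move=> x /set_mem xI; rewrite lee_fin f0.
rewrite t'_pre//; have -> : I01 `&` t @^-1` I01 = I01.
  by apply/seteqP; split => [x []//|x xI]; split => //; exact: T01.
by apply: eq_integral => x /set_mem xI /=; rewrite t'I.
Qed.

Definition density_at w := forall A : set R, measurable A ->
  mu w A = (\int[nu w]_(x in A `&` I01) (phi w x)%:E)%E.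

Lemma density_carrier w : density_at w -> mu w I01 = 1%E.
Proof.
by move=> dw; rewrite dw// setIid -(setTI I01) -dw// probability_setT.
Qed.

Lemma mean_density w : density_at w -> BV (phi w) ->
  (forall x, I01 x -> 0 <= phi w x) -> forall f, BV f ->
  (forall x, I01 x -> 0 <= f x) ->
  mean (mu w) f = mean (nu w) (fun x => f x * phi w x).
Proof.
move=> dw bphi phi0 f bf f0; congr fine.
rewrite (@ge0_integral_density _ _ _ _ (nu w) _ (phi w))//.
- exact: BV_measurable.
- by apply/measurable_EFinP; exact: BV_measurable.
Qed.

Lemma ae_density w (P : R -> Prop) : density_at w -> BV (phi w) ->
  (forall x, I01 x -> 0 <= phi w x) ->
  {ae nu w, forall x, P x} -> {ae mu w, forall x, P x}.
Proof.
move=> dw bphi phi0 [N [mN N0 PN]]; exists N; split => //.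
rewrite dw//; under eq_integral.
  move=> x /set_mem[_ xI]; rewrite -(@gee0_abs _ (phi w x)%:E) ?lee_fin ?phi0//.
  over.
have mNI : measurable (N `&` I01) by exact: measurableI.
apply: integral_abs_eq0 => //.
- apply/measurable_EFinP; apply: measurable_funS (BV_measurable bphi) => //.
- by apply: (subset_measure0 _ _ _ N0) => //; exact: subIsetl.
Qed.

End quenched_cocycle.

(** * Decay of correlations *)

Section decay.
Context d (Omega : topMeasurableType d) (R : realType).
Variables (m : probability Omega R) (S : random_map Omega R).
Hypothesis cs : closed_system m S.
Implicit Types (w : Omega) (f : R -> R).

Local Notation BV := (bounded_variation 0 1).
Local Notation orb := (orb S).
Local Notation Tn := (Tn S).
Local Notation nu := (rm_nu S).
Local Notation mu := (rm_mu S).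
Local Notation phi := (rm_phi S).

(** The properties that hold along almost every orbit, with constants that do
    not depend on the orbit: b bounds the norm of phi, c bounds phi below. *)
Record regular_orbit (b c D kappa : R) w : Prop := {
  ro_conformal : conformal_along S w ;
  ro_equivariant : equivariant_along S w ;
  ro_density : forall k, density_at S (orb k w) ;
  ro_phi_BV : forall k, BV (phi (orb k w)) ;
  ro_phi_ge : forall k x, I01 x -> c <= phi (orb k w) x ;
  ro_phi_norm : forall k, (Bnorm (nu (orb k w)) (phi (orb k w)) < b%:E)%E ;
  ro_gap : forall n f, BV f -> (Bnorm (nu (orb n w))
       (fun x => (ntransfern S n w f x - mean (nu w) f * phi (orb n w) x)%R) <=
     D%:E * Bnorm (nu w) f * (kappa ^+ n)%:E)%E }.

(** By duality the left-hand side is the nu-integral of u' times the iterated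
    transfer of h, the product of u and a representative of phi.  Replacing that
    transfer by its limit nu(h) phi = mu(u) phi gives the main term.  The
    difference F is bounded almost everywhere by its norm, so the error is at
    most a constant times kappa^n times the nu-integral of u', and that integral
    is at most mu(u') / c. *)
Lemma decay_of_correlations b c D kappa w a u u' n :
  0 < b -> 0 < c -> 0 < D -> 0 < kappa -> 0 <= a -> regular_orbit b c D kappa w ->
  var_bound a u -> (forall x, I01 x -> 0 <= u x) ->
  BV u' -> (forall x, I01 x -> 0 <= u' x) ->
  mean (mu w) (fun x => u x * u' (Tn n w x)) <=
  mean (mu w) u * mean (mu (orb n w)) u' +
  D * (4 * (a * b) + 1) / c * kappa ^+ n * mean (mu (orb n w)) u'.
Proof.
move=> b0 c0 D0 k0 a0 reg ua u0 bu' u'0.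
have bu := var_boundBV ua.
have nu1 k : nu (orb k w) I01 = 1%E := cs_nu_carrier cs _.
have phi0 k x : I01 x -> 0 <= phi (orb k w) x.
  by move=> xI; rewrite (le_trans (ltW c0))// (ro_phi_ge reg).
have bphi k := ro_phi_BV reg k.
(* phi itself may have a larger variation than its class *)
have [phi' phi'b phiE] := Bnorm_representative (nu1 0%N)
  (BV_measurable (bphi 0%N)) (ro_phi_norm reg 0).
have bphi' := var_boundBV phi'b.
pose h x := u x * phi' x.
have hb : var_bound (2 * (a * b)) h := var_boundM ua phi'b.
have bh : BV h := var_boundBV hb.
have bu'T : BV (fun x => u' (Tn n w x)) := BV_compTn cs n w bu'.
have eqae f : BV f ->
    mean (nu w) (fun x => f x * phi w x) = mean (nu w) (fun x => f x * phi' x).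
  move=> bf; apply: mean_ae_eq.
  - exact: BV_measurable (BV_mul bf (bphi 0%N)).
  - exact: BV_measurable (BV_mul bf bphi').
  - by apply: filterS phiE => x + xI => /(_ xI) <-.
have -> : mean (mu w) (fun x => u x * u' (Tn n w x)) =
    mean (nu (orb n w)) (fun x => u' x * ntransfern S n w h x).
  rewrite (ntransfern_duality cs (ro_conformal reg))//.
  rewrite (mean_density (ro_density reg 0) (bphi 0%N) (phi0 0%N)); first last.
  - by move=> x xI; rewrite mulr_ge0// ?u0// u'0//; exact: Tn01 cs _ _ _ xI.
  - exact: BV_mul.
  rewrite eqae; last exact: BV_mul.
  by apply: mean_eq => x _; rewrite /h; ring.
have muh : mean (nu w) h = mean (mu w) u.
  by rewrite (mean_density (ro_density reg 0) (bphi 0%N) (phi0 0%N))// eqae.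
have muu' : mean (mu (orb n w)) u' =
    mean (nu (orb n w)) (fun x => u' x * phi (orb n w) x).
  by rewrite (mean_density (ro_density reg n) (bphi n) (phi0 n)).
pose F x := ntransfern S n w h x - mean (nu w) h * phi (orb n w) x.
have bL : BV (ntransfern S n w h) := BV_ntransfern cs n w bh.
have bF : BV F := BV_sub bL (BV_mul (BV_cst _) (bphi n)).
(* h has norm at most 2 * (2 * (a * b)); the extra 1 makes the bound strict *)
pose e := D * (4 * (a * b) + 1) * kappa ^+ n.
have Fe : {ae nu (orb n w), forall x, I01 x -> `|F x| <= e}.
  apply: (ae_le_Bnorm (nu1 n)); first exact: BV_measurable.
  apply: (le_lt_trans (ro_gap reg n bh)).
  apply: (@le_lt_trans _ _ (D%:E * (2 * (2 * (a * b)))%:E * (kappa ^+ n)%:E)%E).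
    apply: lee_wpmul2r; first by rewrite lee_fin exprn_ge0// ltW.
    apply: lee_wpmul2l; first by rewrite lee_fin ltW.
    by have := Bnorm_var_bound (nu1 0%N) hb.
  rewrite -!EFinM lte_fin /e ltr_pM2r ?exprn_gt0// ltr_pM2l//.
  by rewrite mulrA -natrM ltrDl.
have e0 : 0 <= e.
  by rewrite !mulr_ge0 ?exprn_ge0 ?addr_ge0 ?mulr_ge0// ltW.
have -> : mean (nu (orb n w)) (fun x => u' x * ntransfern S n w h x) =
    mean (nu (orb n w)) (fun x => u' x * F x) +
    mean (mu w) u * mean (mu (orb n w)) u'.
  rewrite muu' -muh -mean_scale//; last exact: BV_mul.
  rewrite -[X in _ + X]opprK -[X in _ - X]mulN1r -mean_scale//; last first.
    by apply: BV_mul (BV_cst _) _; exact: BV_mul.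
  rewrite -mean_sub//; last 2 first.
  - exact: BV_mul.
  - by apply: BV_mul (BV_cst _) _; apply: BV_mul (BV_cst _) _; exact: BV_mul.
  by apply: mean_eq => x _; rewrite /F; ring.
rewrite addrC lerD2l.
have u'F : mean (nu (orb n w)) (fun x => u' x * F x) <= e * mean (nu (orb n w)) u'.
  rewrite -mean_scale//; apply: mean_le_ae => //;
    [exact: BV_mul|exact: BV_mul (BV_cst _) bu'|].
  apply: filterS Fe => x + xI => /(_ xI) Fx; rewrite mulrC.
  by rewrite ler_wpM2r ?u'0// (le_trans (ler_norm _)).
rewrite (le_trans u'F)//.
have -> : D * (4 * (a * b) + 1) / c * kappa ^+ n * mean (mu (orb n w)) u' =
    e * (c^-1 * mean (mu (orb n w)) u') by rewrite /e; ring.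
apply: ler_wpM2l => //; rewrite ler_pdivlMl// -mean_scale// muu'.
apply: mean_le => //.
- exact: BV_mul (BV_cst _) bu'.
- exact: BV_mul.
- by move=> x xI; rewrite mulrC ler_wpM2l ?u'0// (ro_phi_ge reg).
Qed.

(** The preimages of a null set under the iterates of the measure preserving
    sigma are null, and there are countably many of them. *)
Lemma ae_orbit (P : Omega -> Prop) : {ae m, forall w, P w} ->
  {ae m, forall w, forall k, P (orb k w)}.
Proof.
have [msig _ mp _] := cs_sigma cs.
have morb k : measurable_fun setT (orb k).
  elim: k => [|k IH]; first exact: measurable_id.
  exact: measurableT_comp msig IH.
have morbm k A : measurable A -> m (orb k @^-1` A) = m A.
  elim: k A => // k IH A mA; rewrite -[RHS](mp A mA) -[RHS]IH//.
  by have := msig measurableT _ mA; rewrite setTI.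
move=> [N [mN N0 PN]]; apply: ae_foralln => k.
exists (orb k @^-1` N); split.
- by have := morb k measurableT _ mN; rewrite setTI.
- exact: etrans (morbm k N mN) N0.
- by move=> w /= nP; exact: PN.
Qed.

Lemma ae_regular_orbit : admissible m S -> exists b c D kappa,
  [/\ 0 < b, 0 < c, 0 < D & 0 < kappa < 1] /\
  {ae m, forall w, forall j, regular_orbit b c D kappa (orb j w)}.
Proof.
move=> [_ _ _ [kappa kappa01 [[D D0 gap] [phi_sup phi_inf _]]]].
have [b b0 phib] : exists2 b, 0 < b &
    {ae m, forall w, (Bnorm (nu w) (phi w) < b%:E)%E}.
  have [b b0 bb] : exists2 b : R, 0 < b &
      (ess_sup m (fun w => Bnorm (nu w) (phi w)) < b%:E)%E.
    case: (ess_sup _ _) phi_sup => [r _|//|_]; last by exists 1; rewrite ?ltr01 ?ltNyr.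
    exists (`|r| + 1); first by rewrite ltr_wpDl.
    by rewrite lte_fin (le_lt_trans (ler_norm r))// ltrDl.
  exists b => //; have := ess_sup_ge m (fun w => Bnorm (nu w) (phi w)).
  by apply: filterS => w /le_lt_trans; apply.
have [c c0 phic] : exists2 c, 0 < c &
    {ae m, forall w, forall x, I01 x -> c <= phi w x}.
  have [c c0 cc] : exists2 c : R, 0 < c &
      (c%:E <= ess_inf m (fun w => inf01 (phi w)))%E.
    case: (ess_inf _ _) phi_inf => [r|_|//]; first by exists r.
    by exists 1 => //; exact: leey.
  exists c => //; have := ess_inf_le m (fun w => inf01 (phi w)).
  apply: filterS => w /(le_trans cc) cw x xI.
  by rewrite -lee_fin (le_trans cw)//; apply: ereal_inf_lbound; exists x.
exists b, c, D, kappa; split => //; apply: ae_orbit.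
have ae_and (P Q : Omega -> Prop) : {ae m, forall w, P w} -> {ae m, forall w, Q w} ->
  {ae m, forall w, P w /\ Q w} by exact: filterS2.
have := ae_and _ _
  (ae_and _ _ (ae_orbit (cs_conformal cs)) (ae_orbit (cs_equivariant cs)))
  (ae_and _ _ (ae_and _ _ (ae_orbit (cs_mu cs)) (ae_orbit (cs_phi_BV cs)))
    (ae_and _ _ (ae_and _ _ (ae_orbit phib) (ae_orbit phic)) gap)).
by apply: filterS => w [[? ?] [[? ?] [[? ?] ?]]]; split.
Qed.

End decay.

(** * Convergence on a generic fibre *)

Section fibre.
Context d (Omega : topMeasurableType d) (R : realType).
Variables (m : probability Omega R) (S : random_map Omega R).
Hypothesis cs : closed_system m S.

Local Notation BV := (bounded_variation 0 1).
Local Notation orb := (orb S).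
Local Notation Tn := (Tn S).
Local Notation nu := (rm_nu S).
Local Notation mu := (rm_mu S).

(** The observables v k enter through nonnegative representatives u k of bounded
    variation: the correlation bound holds for these, and the orbit of almost
    every point never meets the null sets where they differ from v k, because mu
    is equivariant. *)
Lemma fibre_strong_law (v : nat -> Omega -> R -> R) (M b c D kappa : R) w :
  0 < b -> 0 < c -> 0 < D -> 0 < kappa < 1 ->
  (forall j, regular_orbit S b c D kappa (orb j w)) ->
  (forall n w x, I01 x -> 0 <= v n w x) ->
  (forall n w, measurable_fun (I01 : set R) (v n w)) ->
  (forall k, (Bnorm (nu (orb k w)) (v k (orb k w)) <= M%:E)%E) ->
  cumulative_mean S v w n @[n --> \oo] --> +oo ->
  {ae mu w, forall x,
    (cumulative_mean S v w n)^-1 * (\sum_(k < n) v k (orb k w) (Tn k w x))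
      @[n --> \oo] --> (1 : R)}.
Proof.
move=> b0 c0 D0 kappa01 reg v0 mv vM Eoo.
have nu1 w' : nu w' I01 = 1%E := cs_nu_carrier cs w'.
have dens k := ro_density (reg k) 0; have bphi k := ro_phi_BV (reg k) 0.
have mu1 k : mu (orb k w) I01 = 1%E := density_carrier (dens k).
have eqv : equivariant_along S w := ro_equivariant (reg 0%N).
have phi0 k x : I01 x -> 0 <= rm_phi S (orb k w) x.
  by move=> xI; rewrite (le_trans (ltW c0))// (ro_phi_ge (reg k) 0).
have /choice[u Hu] k : exists u, [/\ var_bound (M + 1) u,
    forall x, I01 x -> 0 <= u x &
    {ae mu (orb k w), forall x, I01 x -> v k (orb k w) x = u x}].
  have vM1 : (Bnorm (nu (orb k w)) (v k (orb k w)) < (M + 1)%:E)%E.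
    by rewrite (le_lt_trans (vM k))// lte_fin ltrDl.
  have [g ga vg] := Bnorm_representative (nu1 _) (mv k _) vM1.
  exists (fun x => `|g x|); split => //; first exact: var_bound_abs.
  apply: (ae_density (dens k) (bphi k) (phi0 k)).
  by apply: filterS vg => x + xI => /(_ xI) <-; rewrite ger0_norm// v0.
have ua k : var_bound (M + 1) (u k) by case: (Hu k).
have u0 k x : I01 x -> 0 <= u k x by case: (Hu k) => _ + _; apply.
have bu k : BV (u k) := var_boundBV (ua k).
have M0 : 0 <= M + 1.
  by rewrite (le_trans _ ((ua 0%N).1 0 _))//= in_itv/= lexx ler01.
pose Y k x := u k (Tn k w x).
have push k f : BV f -> (forall x, I01 x -> 0 <= f x) ->
    mean (mu (orb k w)) f = mean (mu w) (fun x => f (Tn k w x)).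
  exact: (mean_equivariant cs eqv mu1).
have bY k : BV (Y k) := BV_compTn cs k w (bu k).
have EY k : mean (mu w) (Y k) = mean (mu (orb k w)) (v k (orb k w)).
  rewrite -push//; last exact: u0.
  apply: mean_ae_eq; [exact: BV_measurable|exact: mv|].
  by case: (Hu k) => _ _; apply: filterS => x + xI => ->.
have bmY : forall k, bounded_measurable (I01 : set R) (Y k).
  move=> k; split; first exact: BV_measurable.
  by exists (M + 1) => x xI; apply: (ua k).1; exact: (Tn01 cs).
have covY j n : mean (mu w) (fun x => Y j x * Y (n + j)%N x) <=
    mean (mu w) (Y j) * mean (mu w) (Y (n + j)%N) +
    D * (4 * ((M + 1) * b) + 1) / c * kappa ^+ n * mean (mu w) (Y (n + j)%N).
  have /andP[kappa0 _] := kappa01.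
  have := decay_of_correlations cs n b0 c0 D0 kappa0 M0 (reg j) (ua j) (u0 j)
    (bu (n + j)%N) (u0 (n + j)%N).
  rewrite -orbD (push _ _ (bu j) (u0 j)) (push _ _ (bu (n + j)%N) (u0 (n + j)%N)).
  rewrite (push j (fun x => u j x * u (n + j)%N (Tn n (orb j w) x))).
  - by under [X in X <= _]eq_Rintegral do rewrite -TnD.
  - exact: BV_mul (bu j) (BV_compTn cs n (orb j w) (bu (n + j)%N)).
  - by move=> x xI; rewrite mulr_ge0// u0//; exact: (Tn01 cs).
have CM n : cumulative_mean S v w n = \sum_(k < n) mean (mu w) (Y k).
  by apply: eq_bigr => k _; rewrite EY.
have vu : {ae mu w, forall x, forall k, I01 x -> v k (orb k w) (Tn k w x) = Y k x}.
  apply: ae_foralln => k.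
  apply: (ae_equivariant cs eqv (P := fun x => v k (orb k w) x = u k x)).
  by case: (Hu k).
have I01ae : {ae mu w, forall x, I01 x}.
  exists (~` I01); split => //; first exact: measurableC.
  rewrite probability_setC// [X in (1 - X)%E](_ : _ = 1%E) ?subee//; exact: (mu1 0%N).
have H : {ae mu w, forall x, I01 x ->
    (\sum_(k < n) mean (mu w) (Y k))^-1 * \sum_(k < n) Y k x @[n --> \oo] --> (1 : R)}.
  apply: (strong_law_slow_means _ (mu1 0%N) _ kappa01 bmY _ covY (b := M + 1)) => //.
  - rewrite divr_ge0// ?(ltW c0)// mulr_ge0// ?(ltW D0)// addr_ge0//.
    by rewrite mulr_ge0// mulr_ge0// ltW.
  - by move=> k x xI; apply/u0/(Tn01 cs).
  - move=> k; rewrite -[leRHS](mean_cst (mu1 0%N)); apply: (mean_le (mu1 0%N)) => //.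
      exact: BV_cst.
    move=> x xI; rewrite (le_trans (ler_norm _))//.
    by apply: (ua k).1; exact: (Tn01 cs).
  - by apply: cvg_trans Eoo; apply: near_eq_cvg; apply: nearW => n; rewrite CM.
near=> x.
have xI : I01 x by near: x.
have vux k : v k (orb k w) (Tn k w x) = Y k x.
  by move: k; near: x; apply: filterS2 I01ae vu => x xI vY k; exact: vY.
have Hx : (\sum_(k < n) mean (mu w) (Y k))^-1 *
    \sum_(k < n) Y k x @[n --> \oo] --> (1 : R).
  by near: x; apply: filterS2 I01ae H => x xI; apply.
apply: cvg_trans Hx; apply: near_eq_cvg; apply: nearW => n.
by rewrite CM; congr (_ * _); apply: eq_bigr => k _; rewrite vux.
Unshelve. all: by end_near. Qed.

End fibre.

Theorem theorem2p6p6 (R : realType) (d : measure_display)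
    (Omega : topMeasurableType d) (m : probability Omega R)
    (S : random_map Omega R) (v : nat -> Omega -> R -> R) (M : R) :
  closed_system m S ->
  admissible m S ->
  (forall n w x, I01 x -> 0 <= v n w x) ->
  (forall n w, measurable_fun (I01 : set R) (v n w)) ->
  (ereal_sup (range (fun n : nat =>
     ess_sup m (fun w => Bnorm (rm_nu S w) (v n w)))) <= M%:E)%E ->
  {ae m, forall w, cumulative_mean S v w n @[n --> \oo] --> +oo} ->
  {ae m, forall w, {ae rm_mu S w, forall x,
    (cumulative_mean S v w n)^-1 * (\sum_(k < n) v k (orb S k w) (Tn S k w x))
      @[n --> \oo] --> (1 : R)}}.
Proof.
move=> cs adm v0 mv vM Eoo.
have [b [c [D [kappa [[b0 c0 D0 kappa01] reg]]]]] := ae_regular_orbit cs adm.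
have vMae : {ae m, forall w, forall n, (Bnorm (rm_nu S w) (v n w) <= M%:E)%E}.
  apply: ae_foralln => n; apply/ess_supP; apply: le_trans vM.
  by apply: ereal_sup_ubound; exists n.
have {}vMae := ae_orbit cs vMae.
apply: filterS3 reg vMae Eoo => w regw vMw Ew.
exact: (fibre_strong_law cs b0 c0 D0 kappa01 regw).
Qed.
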